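(* Let $\Omega$ be an infinite set. Then there exists a $0,1$-lattice embedding (a one-to-one lattice homomorphism preserving least and greatest elements) from $(\operatorname{Eq}\Omega)\amalg^0(\operatorname{Eq}\Omega)$ into $\operatorname{Eq}\Omega$.
   Context: $\operatorname{Eq}\Omega$ denotes the lattice of all equivalence relations on the set $\Omega$, ordered by inclusion. For lattices with zero $L_1,L_2$, $L_1\amalg^0 L_2$ denotes their $0$-coproduct, i.e. their coproduct (free product) in the category of lattices with zero and zero-preserving lattice homomorphisms. *)

(* Defs.v *)
From Stdlib Require Import List Relations.

Definition infinite (T : Type) : Prop :=
  ~ exists l : list T, forall x : T, In x l.

Record lat0 := Lat0 {
  lcar :> Type;
  lmeet : lcar -> lcar -> lcar;
  ljoin : lcar -> lcar -> lcar;
  lzero : lcar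
}.
Arguments lmeet {l} _ _.
Arguments ljoin {l} _ _.
Arguments lzero {l}.

Definition is_lattice0 (L : lat0) : Prop :=
  (forall x y z : L, lmeet x (lmeet y z) = lmeet (lmeet x y) z) /\
  (forall x y z : L, ljoin x (ljoin y z) = ljoin (ljoin x y) z) /\
  (forall x y : L, lmeet x y = lmeet y x) /\
  (forall x y : L, ljoin x y = ljoin y x) /\
  (forall x y : L, lmeet x (ljoin x y) = x) /\
  (forall x y : L, ljoin x (lmeet x y) = x) /\
  (forall x : L, ljoin lzero x = x).

Definition hom0 (L M : lat0) (f : L -> M) : Prop :=
  (forall x y : L, f (lmeet x y) = lmeet (f x) (f y)) /\
  (forall x y : L, f (ljoin x y) = ljoin (f x) (f y)) /\
  f lzero = lzero.

Definition is_coproduct0 (L1 L2 C : lat0) (i1 : L1 -> C) (i2 : L2 -> C) : Prop :=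
  is_lattice0 C /\ hom0 L1 C i1 /\ hom0 L2 C i2 /\
  forall (M : lat0), is_lattice0 M ->
  forall (f1 : L1 -> M) (f2 : L2 -> M), hom0 L1 M f1 -> hom0 L2 M f2 ->
  exists! h : C -> M,
    hom0 C M h /\ (forall x, h (i1 x) = f1 x) /\ (forall y, h (i2 y) = f2 y).

Definition is_equiv {O : Type} (R : O -> O -> Prop) : Prop :=
  (forall x, R x x) /\ (forall x y, R x y -> R y x) /\
  (forall x y z, R x y -> R y z -> R x z).

Definition EqRel (O : Type) : Type := { R : O -> O -> Prop | is_equiv R }.

Definition eq_meet {O : Type} (A B : EqRel O) : EqRel O.
Proof.
  destruct A as [R [r [s t]]], B as [S [r' [s' t']]].
  exists (fun x y => R x y /\ S x y).
  split; [|split]; intros; firstorder eauto.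
Defined.

Definition eq_join {O : Type} (A B : EqRel O) : EqRel O.
Proof.
  destruct A as [R [r [s t]]], B as [S [r' [s' t']]].
  exists (clos_trans O (fun x y => R x y \/ S x y)).
  split; [|split].
  - intro x; apply t_step; left; apply r.
  - intros x y H; induction H as [x y [H|H]| x y z _ IH1 _ IH2].
    + apply t_step; left; auto.
    + apply t_step; right; auto.
    + eapply t_trans; eauto.
  - intros x y z H1 H2; eapply t_trans; eauto.
Defined.

Definition eq_bot (O : Type) : EqRel O.
Proof.
  exists (fun x y => x = y).
  split; [|split]; intros; subst; auto.
Defined.

Definition eq_top (O : Type) : EqRel O.
Proof.
  exists (fun _ _ => True).
  split; [|split]; auto.
Defined.

Definition EqL (O : Type) : lat0 := Lat0 (EqRel O) eq_meet eq_join (eq_bot O).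

(* Main.v *)
From mathcomp Require Import all_boot.
From mathcomp Require Import boolp classical_sets functions cardinality.
From Stdlib Require Import Relation_Operators.
Require Import Defs.
Local Open Scope classical_set_scope.

(** The 0-coproduct of two copies of Eq(O) consists of lattice terms over two copies of
    Eq(O), ordered by a Whitman-style calculus.  In this order every term is
    determined by its approximations, the terms below it whose labels are finitely
    generated equivalence relations: the map sending a term to the ideal of finitely
    generated terms below it is a lattice embedding, by a pigeonhole argument over the
    rules of the calculus.  There are only |O| finitely generated terms, because O
    carries an injective pairing.  Finally the ideal lattice of any join-semilattice with zero
    embeds into a partition lattice: take a graph with labelled edges in which every edge
    with label below a \/ b is bypassed by a path labelled a, b, a, b, and send an
    ideal I to connectedness through edges with label in I. *)

(** * Infinite sets *)

(** [EqRel O] has more elements than [O], so a graph with a tip for every element of the coproduct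
    would be too large; ideals of finitely generated terms keep the vertex set at the size of [O]
    and still record every term. The bypass a, b, a, b is the shortest alternating one that respects
    meets. Let the bypassed edge have label zero and let a, b be nonzero with meet zero. On a path
    a, b the middle vertex is identified with the ends by a alone and by b alone, but not by their
    meet; on a path a, b, a the same happens to the two inner vertices. On a, b, a, b the two
    groupings of inner vertices and ends have nothing in common. The coproduct [C] is known only by
    its universal property. Terms exhaust [C] and [tle] is sound there; completeness is a by-product
    of the map out of [C], which sends the value of a term to its representation, because the
    representation reflects [tle]. *)

Definition pairing {T : Type} (p : T -> T -> T) : Prop :=
  forall x y x' y', p x y = p x' y' -> x = x' /\ y = y'.

(** A maximal partial injective matching between [A] and [B] exhausts one of them, since otherwise
    an unmatched pair could be added. [t0] is the default value outside the matched set. *)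
Lemma set_comparable (T : Type) (t0 : T) (A B : set T) :
  (exists f : T -> T, set_fun A B f /\ set_inj A f) \/
  (exists f : T -> T, set_fun B A f /\ set_inj B f).
Proof.
pose P (G : set (T * T)) := [/\ (forall x y, G (x, y) -> A x /\ B y),
  (forall x y y', G (x, y) -> G (x, y') -> y = y') &
  (forall x x' y, G (x, y) -> G (x', y) -> x = x')].
have [F FP Ftot|G [[GAB Gfun Ginj] Gmax]] := @Zorn_bigcup _ P.
  split=> [x y [X FX Xxy]|x y y' [X FX Xxy] [Y FY Yxy]|x x' y [X FX Xxy] [Y FY Yxy]].
  - by have [/(_ _ _ Xxy)] := FP _ FX.
  - have [_ fX _] := FP _ FX; have [_ fY _] := FP _ FY.
    have [XY|YX] := Ftot _ _ FX FY.
      by apply: (fY x) => //; apply: XY.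
    by apply: (fX x) => //; apply: YX.
  - have [_ _ fX] := FP _ FX; have [_ _ fY] := FP _ FY.
    have [XY|YX] := Ftot _ _ FX FY.
      by apply: (fY _ _ y) => //; apply: XY.
    by apply: (fX _ _ y) => //; apply: YX.
have [domA|ndomA] := EM (forall x, A x -> exists y, G (x, y)).
  have /choice[f fG] : forall x, exists y, A x -> G (x, y).
    by move=> x; have [/domA[y ?]|nAx] := EM (A x); [exists y|exists t0].
  left; exists f; split; first by move=> x /fG /GAB[].
  move=> x y /set_mem Ax /set_mem Ay fxy; apply: (Ginj _ _ (f x)); first exact: fG.
  by rewrite fxy; exact: fG.
have [domB|ndomB] := EM (forall y, B y -> exists x, G (x, y)).
  have /choice[f fG] : forall y, exists x, B y -> G (x, y).
    by move=> y; have [/domB[x ?]|nBx] := EM (B y); [exists x|exists t0].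
  right; exists f; split; first by move=> x /fG /GAB[].
  move=> x y /set_mem Ax /set_mem Ay fxy; apply: (Gfun (f x)); first exact: fG.
  by rewrite fxy; exact: fG.
exfalso.
move/existsNP: ndomA => [x /not_implyP[Ax nGx]].
move/existsNP: ndomB => [y /not_implyP[By nGy]].
apply: (Gmax (G `|` [set (x, y)])).
  split; first by left.
  by move/(_ (x, y)) => /(_ (or_intror erefl)) Gxy; apply: nGx; exists y.
split=> [u v [/GAB//|[-> ->]//]|u v v'|u u' v].
- move=> [Guv|[uE vE]] [Guv'|[uE' vE']]; subst => //; first exact: (Gfun u).
  + by case: nGx; exists v.
  + by case: nGx; exists v'.
- move=> [Guv|[uE vE]] [Guv'|[uE' vE']]; subst => //; first exact: (Ginj _ _ v).
  + by case: nGy; exists u.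
  + by case: nGy; exists u'.
Qed.

Section TaggedPairing.
Context {T : Type} (A D : set T) (q : T -> T -> T) (c0 c1 : T) (r : T -> T).
Hypothesis q_in : forall x y, A x -> A y -> A (q x y).
Hypothesis q_inj : forall x y x' y', A x -> A y -> A x' -> A y' ->
  q x y = q x' y' -> x = x' /\ y = y'.
Hypotheses (Ac0 : A c0) (Ac1 : A c1) (c01 : c0 <> c1).
Hypothesis r_in : forall x, D x -> A (r x).
Hypothesis r_injA : forall x y, D x -> D y -> A x -> A y -> r x = r y -> x = y.
Hypothesis r_injC : forall x y, D x -> D y -> ~ A x -> ~ A y -> r x = r y -> x = y.

Definition side (x : T) : T := if `[<A x>] then c0 else c1.

(** [r] is injective only on each of the two pieces of [D], inside and outside [A]. Recording the
    piece by [c0] or [c1] gives an injection of the square of [D] into [A], in place of the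
    absorption laws of cardinal arithmetic. *)
Definition tagged_pair (x y : T) : T := q (q (side x) (side y)) (q (r x) (r y)).

Lemma side_in x : A (side x).
Proof. by rewrite /side; case: asboolP. Qed.

Lemma side_r_inj x y : D x -> D y -> side x = side y -> r x = r y -> x = y.
Proof.
move=> Dx Dy; rewrite /side; case: asboolP => Ax; case: asboolP => Ay E rxy.
- exact: r_injA.
- by case: c01.
- by case: c01.
- exact: r_injC.
Qed.

Lemma tagged_pair_in x y : D x -> D y -> A (tagged_pair x y).
Proof.
by move=> /r_in rx /r_in ry; apply: q_in; apply: q_in => //; apply: side_in.
Qed.

Lemma tagged_pair_inj x y x' y' : D x -> D y -> D x' -> D y' ->
  tagged_pair x y = tagged_pair x' y' -> x = x' /\ y = y'.
Proof.
move=> Dx Dy Dx' Dy'; move: (side_in x) (side_in y) (side_in x') (side_in y').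
move: (r_in _ Dx) (r_in _ Dy) (r_in _ Dx') (r_in _ Dy') => rx ry rx' ry' tx ty tx' ty'.
move=> E; have [|||| Et Er] := q_inj _ _ _ _ _ _ _ _ E; do ?exact: q_in.
have [txx' tyy'] := q_inj _ _ _ _ tx ty tx' ty' Et.
have [rxx' ryy'] := q_inj _ _ _ _ rx ry rx' ry' Er.
by split; apply: side_r_inj.
Qed.

End TaggedPairing.

(** A partial pairing is the graph of an injection of the square of a set into that set, so the set
    can be read off the diagonal. *)
Definition pairing_field {T : Type} (G : set (T * T * T)) (x : T) : Prop :=
  exists z, G (x, x, z).

Definition partial_pairing {T : Type} (G : set (T * T * T)) : Prop :=
  [/\ forall x y z z', G (x, y, z) -> G (x, y, z') -> z = z',
      forall x y x' y' z, G (x, y, z) -> G (x', y', z) -> x = x' /\ y = y',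
      forall x y z, G (x, y, z) ->
        [/\ pairing_field G x, pairing_field G y & pairing_field G z] &
      forall x y, pairing_field G x -> pairing_field G y -> exists z, G (x, y, z)].

Lemma partial_pairing_bigcup {T : Type} (F : set (set (T * T * T))) :
  F `<=` partial_pairing -> total_on F subset ->
  partial_pairing (\bigcup_(X in F) X).
Proof.
move=> Fp Ftot.
have join X Y : F X -> F Y -> exists2 Z, F Z & X `<=` Z /\ Y `<=` Z.
  by move=> FX FY; have [XY|YX] := Ftot _ _ FX FY; [exists Y|exists X]; do ?split.
have fieldS X x : F X -> pairing_field X x -> pairing_field (\bigcup_(X in F) X) x.
  by move=> FX [z Xz]; exists z, X.
split.
- move=> x y z z' [X FX Xz] [Y FY Yz]; have [Z FZ [XZ YZ]] := join _ _ FX FY.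
  by have [h _ _ _] := Fp _ FZ; exact: (h _ _ _ _ (XZ _ Xz) (YZ _ Yz)).
- move=> x y x' y' z [X FX Xz] [Y FY Yz]; have [Z FZ [XZ YZ]] := join _ _ FX FY.
  by have [_ h _ _] := Fp _ FZ; exact: (h _ _ _ _ _ (XZ _ Xz) (YZ _ Yz)).
- move=> x y z [X FX Xz]; have [_ _ h _] := Fp _ FX.
  by have [? ? ?] := h _ _ _ Xz; split; apply: (fieldS X).
- move=> x y [z [X FX Xz]] [z' [Y FY Yz]]; have [Z FZ [XZ YZ]] := join _ _ FX FY.
  have [_ _ _ h] := Fp _ FZ.
  have [||w Zw] := h x y; first by exists z; apply: XZ.
    by exists z'; apply: YZ.
  by exists w, Z.
Qed.

Lemma finite_set_list (T : Type) (A : set T) :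
  finite_set A -> exists l : list T, forall x, A x -> List.In x l.
Proof.
elim/Peq: T A => T A /finite_seqP[s ->]; exists s => x /=.
by elim: s => //= a s IH; rewrite inE => /orP[/eqP->|/IH]; [left|right].
Qed.

Lemma infinite_nat_inj (T : Type) : infinite T ->
  exists c : nat -> T, forall m n, c m = c n -> m = n.
Proof.
move=> Tinf; have : infinite_set [set: T].
  by move/finite_set_list => [l Hl]; apply: Tinf; exists l => x; apply: Hl.
have [t] : exists t : T, True.
  by apply: contrapT => nT; apply: Tinf; exists nil => x; case: nT; exists x.
move=> _; elim/Ppointed: T t Tinf => T; first by move=> t; case: (no t).
move=> t _ /infiniteP/pcard_leP[f]; exists f => m n mn.
by apply: ('inj_f) => //; rewrite inE.
Qed.

(** The Zorn argument for kappa^2 = kappa. If the complement of the field [A] of a maximal partial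
    pairing injects into [A], tagging extends the pairing to [T]; if [A] injects into its
    complement, a copy [B] of [A] can be adjoined to the field, against maximality. *)
Lemma infinite_pairing (T : Type) : infinite T -> exists p : T -> T -> T, pairing p.
Proof.
move=> /infinite_nat_inj[c c_inj].
pose code (m n : nat) := c (pickle (m, n)).
have code_inj m n m' n' : code m n = code m' n' -> m = m' /\ n = n'.
  by move=> /c_inj /(pcan_inj pickleK)[-> ->].
pose G0 : set (T * T * T) :=
  [set xyz | exists m n, xyz = (c m, c n, code m n)].
have G0_field m : pairing_field G0 (c m) by exists (code m m), m, m.
have G0_pairing : partial_pairing G0.
  split.
  - move=> _ _ _ _ [m [n [-> -> ->]]] [m' [n' [/c_inj -> /c_inj -> ->]]] //.
  - move=> _ _ _ _ _ [m [n [-> -> ->]]] [m' [n' [-> -> /code_inj[-> ->]]]] //.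
  - by move=> _ _ _ [m [n [-> -> ->]]]; split; exact: G0_field.
  - move=> x y [z [m [_ [-> _ _]]]] [z' [m' [_ [-> _ _]]]].
    by exists (code m m'), m, m'.
pose P (G : set (T * T * T)) := partial_pairing G /\ (G `<=` set0 \/ G0 `<=` G).
have [F FP Ftot|G [[Gp G0G] Gmax]] := @Zorn_bigcup _ P.
  split; first by apply: partial_pairing_bigcup => // X /FP[].
  have [[X FX G0X]|nF] := EM (exists2 X, F X & G0 `<=` X).
    by right=> x /G0X Xx; exists X.
  left=> x [X FX Xx]; have [_ [X0|G0X]] := FP _ FX; first exact: X0 _ Xx.
  by case: nF; exists X.
have {}G0G : G0 `<=` G.
  case: G0G => // G_0; exfalso; apply: (Gmax G0); last by split=> //; right=> x.
  split; first by move=> x /G_0.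
  by move=> /(_ (c 0, c 0, code 0 0)) G0G; apply: (G_0 (c 0, c 0, code 0 0));
    apply: G0G; exists 0, 0.
pose A := pairing_field G.
have Ac n : A (c n) by have [z zG] := G0_field n; exists z; exact: G0G.
have [Gfun Ginj Gin Gex] := Gp.
have /choice[q' q'G] : forall xy : T * T, exists z, A xy.1 -> A xy.2 -> G (xy.1, xy.2, z).
  move=> [x y]; have [[Ax Ay]|nA] := EM (A x /\ A y).
    by have [z zG] := Gex _ _ Ax Ay; exists z.
  by exists x => Ax Ay; case: nA.
pose q x y := q' (x, y).
have qG x y : A x -> A y -> G (x, y, q x y) by exact: (q'G (x, y)).
have q_in x y : A x -> A y -> A (q x y).
  by move=> Ax Ay; have [] := Gin _ _ _ (qG _ _ Ax Ay).
have q_inj x y x' y' : A x -> A y -> A x' -> A y' -> q x y = q x' y' -> x = x' /\ y = y'.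
  move=> Ax Ay Ax' Ay' E; apply: (Ginj _ _ _ _ (q x y)); first exact: qG.
  by rewrite E; exact: qG.
have c01 : c 0 <> c 1 by move/c_inj.
have [[j [jA j_inj]]|[k [kA k_inj]]] := set_comparable T (c 0) (~` A) A.
  pose r x := if `[<A x>] then x else j x.
  have rA x : A x -> r x = x by rewrite /r => /asboolT ->.
  have rC x : ~ A x -> r x = j x by rewrite /r => /asboolF ->.
  exists (tagged_pair A q (c 0) (c 1) r) => x y x' y'.
  apply: (@tagged_pair_inj _ _ setT) => // {x y x' y'}.
  - by move=> x _; have [/[dup] /rA -> //|/[dup] /rC -> /jA] := EM (A x).
  - by move=> x y _ _ /rA -> /rA ->.
  - by move=> x y _ _ nx ny; rewrite (rC _ nx) (rC _ ny); apply: j_inj; rewrite inE.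
exfalso.
pose B := k @` A; pose D := A `|` B.
have BA x : B x -> ~ A x by move=> [y /kA kyA <-].
have /choice[kinv kinvK] : forall x, exists y, B x -> A y /\ k y = x.
  move=> x; have [[y Ay <-]|nB] := EM (B x); first by exists y.
  by exists x.
pose r x := if `[<A x>] then x else kinv x.
have rA x : A x -> r x = x by rewrite /r => /asboolT ->.
have rB x : B x -> A (r x) /\ k (r x) = x.
  by move=> Bx; rewrite /r (asboolF (BA _ Bx)); exact: kinvK.
have DB x : D x -> ~ A x -> B x by case.
have r_in x : D x -> A (r x) by case=> [/[dup] /rA ->|/rB[]].
have r_injA x y : D x -> D y -> A x -> A y -> r x = r y -> x = y.
  by move=> _ _ /rA -> /rA ->.
have r_injC x y : D x -> D y -> ~ A x -> ~ A y -> r x = r y -> x = y.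
  move=> Dx Dy /(DB _ Dx)/rB[_ kx] /(DB _ Dy)/rB[_ ky] E.
  by rewrite -kx -ky E.
pose s := tagged_pair A q (c 0) (c 1) r.
have s_in x y : D x -> D y -> A (s x y) by apply: tagged_pair_in.
have s_inj x y x' y' : D x -> D y -> D x' -> D y' -> s x y = s x' y' -> x = x' /\ y = y'.
  by apply: tagged_pair_inj.
(* [N] treats the pairs from [D] that [G] leaves open. Its values lie in [B], which is disjoint from
   [A], so they cannot clash with values of [G]. *)
pose N (xyz : T * T * T) := [/\ D xyz.1.1, D xyz.1.2, ~ (A xyz.1.1 /\ A xyz.1.2) &
  xyz.2 = k (s xyz.1.1 xyz.1.2)].
have NB x y z : N (x, y, z) -> B z.
  by move=> [/= Dx Dy _ ->]; exists (s x y) => //; exact: s_in.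
have fieldD x : pairing_field (G `|` N) x = D x.
  apply/propext; split=> [[z [/Gin[]|[]//]]|]; first by left.
  move=> Dx; have [[z Gz]|nAx] := EM (A x); first by exists z; left.
  by exists (k (s x x)); right; split=> //= -[].
have GD x y z : G (x, y, z) -> [/\ A x, A y & A z] by exact: Gin.
apply: (Gmax (G `|` N)).
  split=> [x Gx|]; first by left.
  pose b := k (c 0); have Bb : B b by exists (c 0).
  move=> /(_ (b, b, k (s b b))) Gb; have : G (b, b, k (s b b)).
    by apply: Gb; right; split; [right|right| move=> [/(BA _ Bb)]|].
  by case/GD => /(BA _ Bb).
split; last by right=> x /G0G; left.
split.
- move=> x y z z' [xyz|[/= Dx Dy nA ->]] [xyz'|[/= Dx' Dy' nA' ->]] //.
  + exact: Gfun xyz xyz'.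
  + by case: nA'; have [] := GD _ _ _ xyz.
  + by case: nA; have [] := GD _ _ _ xyz'.
- move=> x y x' y' z [xyz|Nz] [xyz'|Nz'].
  + exact: Ginj xyz xyz'.
  + by have [_ _ Az] := GD _ _ _ xyz; case: (BA _ (NB _ _ _ Nz')).
  + by have [_ _ Az] := GD _ _ _ xyz'; case: (BA _ (NB _ _ _ Nz)).
  + case: Nz Nz' => /= Dx Dy _ -> [/= Dx' Dy' _ /k_inj E]; apply: s_inj => //.
    by apply: E; rewrite inE; exact: s_in.
- move=> x y z H; rewrite !fieldD; case: H => [/GD[? ? ?]|/[dup] /NB Bz [/= Dx Dy _ _]].
    by split; left.
  by split=> //; right.
- move=> x y; rewrite !fieldD => Dx Dy; have [[Ax Ay]|nA] := EM (A x /\ A y).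
    by exists (q x y); left; exact: qG.
  by exists (k (s x y)); right; split.
Qed.

(** * Equivalence relations *)

Lemma EqRel_ext (O : Type) (a b : EqRel O) :
  (forall x y, sval a x y <-> sval b x y) -> a = b.
Proof.
case: a b => [a Ha] [b Hb] ab; apply: eq_exist.
by do 2!apply: funext => ?; apply: propext; exact: ab.
Qed.

Lemma eq_meetE (O : Type) (a b : EqRel O) x y :
  sval (eq_meet a b) x y <-> sval a x y /\ sval b x y.
Proof. by case: a b => [R [? [? ?]]] [R' [? [? ?]]]. Qed.

Lemma eq_joinE (O : Type) (a b : EqRel O) x y :
  sval (eq_join a b) x y <->
  clos_trans O (fun x y => sval a x y \/ sval b x y) x y.
Proof. by case: a b => [R [? [? ?]]] [R' [? [? ?]]]. Qed.

Section EqRelOrder.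
Context {O : Type}.
Implicit Types a b c : EqRel O.

Definition ele a b : Prop := forall x y, sval a x y -> sval b x y.

Lemma ele_refl a : ele a a. Proof. by []. Qed.

Lemma ele_trans a b c : ele a b -> ele b c -> ele a c.
Proof. by move=> ab bc x y /ab/bc. Qed.

Lemma ele_antisym a b : ele a b -> ele b a -> a = b.
Proof. by move=> ab ba; apply: EqRel_ext => x y; split; [exact: ab | exact: ba]. Qed.

Lemma EqRel_refl a x : sval a x x.
Proof. by case: a => R [? [? ?]] /=. Qed.

Lemma EqRel_sym a x y : sval a x y -> sval a y x.
Proof. by case: a => R [? [H ?]] /=; exact: H. Qed.

Lemma EqRel_trans a x y z : sval a x y -> sval a y z -> sval a x z.
Proof. by case: a => R [? [? H]] /=; exact: H. Qed.

Lemma bot_ele a : ele (eq_bot O) a.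
Proof. by move=> x _ <-; exact: EqRel_refl. Qed.

Lemma meet_elel a b : ele (eq_meet a b) a.
Proof. by move=> x y /eq_meetE[]. Qed.

Lemma meet_eler a b : ele (eq_meet a b) b.
Proof. by move=> x y /eq_meetE[]. Qed.

Lemma ele_meet a b c : ele c a -> ele c b -> ele c (eq_meet a b).
Proof. by move=> ca cb x y cxy; apply/eq_meetE; split; [exact: ca | exact: cb]. Qed.

Lemma ele_joinl a b : ele a (eq_join a b).
Proof. by move=> x y axy; apply/eq_joinE/t_step; left. Qed.

Lemma ele_joinr a b : ele b (eq_join a b).
Proof. by move=> x y bxy; apply/eq_joinE/t_step; right. Qed.

Lemma join_ele a b c : ele a c -> ele b c -> ele (eq_join a b) c.
Proof.
move=> ac bc x y /eq_joinE; elim=> {x y} [x y [/ac|/bc]|x y z _ xy _ yz] //.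
exact: EqRel_trans xy yz.
Qed.

Lemma join_mono a b a' b' : ele a a' -> ele b b' -> ele (eq_join a b) (eq_join a' b').
Proof.
by move=> aa' bb'; apply: join_ele;
  [apply: ele_trans aa' _; exact: ele_joinl | apply: ele_trans bb' _; exact: ele_joinr].
Qed.

Definition gen (l : list (O * O)) : EqRel O :=
  exist _ (clos_refl_sym_trans O (fun x y => List.In (x, y) l))
    (conj (rst_refl _ _) (conj (rst_sym _ _) (rst_trans _ _))).

Lemma gen_ele l a : (forall x y, List.In (x, y) l -> sval a x y) -> ele (gen l) a.
Proof.
move=> la x y /=; elim=> {x y} [x y /la //|x|x y _|x y z _ xy _ yz].
- exact: EqRel_refl.
- exact: EqRel_sym.
- exact: EqRel_trans xy yz.
Qed.

Lemma gen_in l x y : List.In (x, y) l -> sval (gen l) x y.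
Proof. exact: rst_step. Qed.

Definition fg a : Prop := exists l, a = gen l.

Lemma fg_bot : fg (eq_bot O).
Proof. by exists nil; apply: ele_antisym; [exact: bot_ele | exact: gen_ele]. Qed.

Lemma fg_join a b : fg a -> fg b -> fg (eq_join a b).
Proof.
move=> [l ->] [l' ->]; exists (l ++ l')%list; apply: ele_antisym.
  by apply: join_ele; apply: gen_ele => x y H; apply: gen_in;
    apply: List.in_or_app; [left | right].
by apply: gen_ele => x y /(List.in_app_or _ _ _)[] H; [apply: ele_joinl | apply: ele_joinr];
  exact: gen_in.
Qed.

(** Special to partition lattices: all nontrivial pairs of [gen l] lie in the finite support of [l],
    so a smaller equivalence is generated by a finite list of its own pairs. Hence meets with
    finitely generated labels stay finitely generated, as [up_fg] requires. *)
Lemma fg_ele a b : fg b -> ele a b -> fg a.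
Proof.
move=> [l ->] al.
pose s := (List.map fst l ++ List.map snd l)%list.
have gen_s x y : sval (gen l) x y -> x = y \/ List.In x s /\ List.In y s.
  elim=> {x y} [x y xyl|x|x y _|x y z _ xy _ yz]; try by left.
  - by right; split; apply: List.in_or_app; [left|right];
      [exact: (List.in_map fst _ _ xyl) | exact: (List.in_map snd _ _ xyl)].
  - by case=> [->|[]]; [left | right].
  - by case: xy => [->//|[xs ys]]; case: yz => [<-|[_ zs]]; right.
exists (List.filter (fun xy => `[< sval a xy.1 xy.2 >]) (List.list_prod s s)).
apply: ele_antisym => [x y axy|]; last first.
  by apply: gen_ele => x y /List.filter_In[_ /asboolP].
case: (gen_s _ _ (al _ _ axy)) => [->|[xs ys]]; first exact: EqRel_refl.
by apply/gen_in/List.filter_In; split; [exact: List.in_prod | exact/asboolP].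
Qed.

(** Compactness: each generating pair of [c] is reached by a finite chain of steps in [a] or [b],
    and the steps used for all generators generate [a'] and [b']. *)
Lemma fg_ele_join a b c : fg c -> ele c (eq_join a b) ->
  exists a' b', [/\ fg a', fg b', ele a' a, ele b' b & ele c (eq_join a' b')].
Proof.
have fg2 x y : fg (gen ((x, y) :: nil)) by eexists.
have gen2 d x y : sval d x y -> ele (gen ((x, y) :: nil)) d.
  by move=> dxy; apply: gen_ele => u v [[<- <-]|[]].
have merge d e : (exists a' b', [/\ fg a', fg b', ele a' a, ele b' b & ele d (eq_join a' b')]) ->
    (exists a' b', [/\ fg a', fg b', ele a' a, ele b' b & ele e (eq_join a' b')]) ->
    exists a' b', [/\ fg a', fg b', ele a' a, ele b' b & ele (eq_join d e) (eq_join a' b')].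
  move=> [a1 [b1 [fa1 fb1 aa1 bb1 d1]]] [a2 [b2 [fa2 fb2 aa2 bb2 e2]]].
  exists (eq_join a1 a2), (eq_join b1 b2); split; do ?[exact: fg_join | exact: join_ele].
  apply: join_ele; [apply: ele_trans d1 _ | apply: ele_trans e2 _]; apply: join_mono;
    do ?[exact: ele_joinl | exact: ele_joinr].
move=> [l ->] {c}; elim: l => [|[x y] l IH] H.
  exists (eq_bot O), (eq_bot O); split; do ?[exact: fg_bot | exact: bot_ele].
  exact: gen_ele.
have [||a1 [b1 [fa1 fb1 aa1 bb1 H1]]] := merge (gen ((x, y) :: nil)) (gen l).
- have : sval (eq_join a b) x y by apply: H; apply: gen_in; left.
  move/eq_joinE; elim=> {x y H} [x y [axy|bxy]|x y z _ IHx _ IHy].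
  + exists (gen ((x, y) :: nil)), (eq_bot O).
    by split; do ?[exact: fg_bot | exact: bot_ele | exact: gen2 | exact: fg2];
      exact: ele_joinl.
  + exists (eq_bot O), (gen ((x, y) :: nil)).
    by split; do ?[exact: fg_bot | exact: bot_ele | exact: gen2 | exact: fg2];
      exact: ele_joinr.
  + have [a' [b' [? ? ? ? H']]] := merge _ _ IHx IHy.
    exists a', b'; split=> //; apply: gen2; apply: (EqRel_trans _ _ y); apply: H'.
      by apply: ele_joinl; apply: gen_in; left.
    by apply: ele_joinr; apply: gen_in; left.
- by apply: IH; apply: ele_trans H; apply: gen_ele => u v H; apply: gen_in; right.
exists a1, b1; split=> //; apply: ele_trans H1; apply: gen_ele => u v [[<- <-]|uv].
  by apply: ele_joinl; apply: gen_in; left.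
by apply: ele_joinr; apply: gen_in.
Qed.

End EqRelOrder.

(** * Ideals of a join-semilattice as equivalence relations *)

Section SemilatticeGraph.
Context {S : Type} (le : S -> S -> Prop) (join : S -> S -> S) (zero : S).
Hypothesis le_trans : forall t u v, le t u -> le u v -> le t v.
Hypothesis zero_le : forall t, le zero t.
Hypothesis le_joinl : forall t u, le t (join t u).
Hypothesis le_joinr : forall t u, le u (join t u).
Hypothesis join_le : forall t u v, le t v -> le u v -> le (join t u) v.

Record ideal (I : S -> Prop) : Prop := Ideal {
  ideal0 : I zero;
  ideal_down : forall t u, le t u -> I u -> I t;
  ideal_join : forall t u, I t -> I u -> I (join t u)
}.

Definition ideal_meet (I J : S -> Prop) : S -> Prop := fun t => I t /\ J t.

Definition ideal_sup (I J : S -> Prop) : S -> Prop :=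
  fun t => exists u v, [/\ I u, J v & le t (join u v)].

Definition ideal_bot : S -> Prop := fun t => le t zero.

Lemma ideal_meetP I J : ideal I -> ideal J -> ideal (ideal_meet I J).
Proof.
move=> HI HJ; split; first by split; exact: ideal0.
  by move=> t u tu [Iu Ju]; split; apply: (ideal_down _ _ _ _ tu).
by move=> t u [? ?] [? ?]; split; apply: ideal_join.
Qed.

Lemma ideal_botP : ideal ideal_bot.
Proof.
by split; [exact: zero_le | move=> t u; exact: le_trans | move=> t u; exact: join_le].
Qed.

Lemma ideal_bot_sub I : ideal I -> forall t, ideal_bot t -> I t.
Proof. by move=> HI t /(ideal_down _ HI); apply; exact: ideal0. Qed.

Lemma ideal_supP I J : ideal I -> ideal J -> ideal (ideal_sup I J).
Proof.
move=> HI HJ; split.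
- by exists zero, zero; split; [exact: ideal0 | exact: ideal0 | exact: zero_le].
- by move=> t u tu [v [w [Iv Jw uvw]]]; exists v, w; split=> //; exact: le_trans uvw.
- move=> t u [v [w [Iv Jw tvw]]] [v' [w' [Iv' Jw' uvw]]].
  exists (join v v'), (join w w'); split; try by apply: ideal_join.
  apply: join_le.
    apply: (le_trans _ _ _ tvw); apply: join_le.
      by apply: (le_trans _ (join v v')).
    by apply: (le_trans _ (join w w')).
  apply: (le_trans _ _ _ uvw); apply: join_le.
    by apply: (le_trans _ (join v v')).
  by apply: (le_trans _ (join w w')).
Qed.

(* The edges [Sub e a b _] form a path parallel to [e] with three new inner vertices,
   which carries
   the labels [a], [b], [a], [b] when [label e <= a \/ b]; otherwise [fit] gives all of them the
   label of [e], so that the construction needs no side condition. *)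
Inductive step := Step1 | Step2 | Step3 | Step4.
Inductive spot := Spot1 | Spot2 | Spot3.

Inductive edge :=
| Base (t : S)
| Sub (e : edge) (a b : S) (j : step).

Inductive vertex :=
| Root
| Tip (t : S)
| Mid (e : edge) (a b : S) (k : spot).

Fixpoint source (e : edge) : vertex :=
  match e with
  | Base _ => Root
  | Sub e a b Step1 => source e
  | Sub e a b Step2 => Mid e a b Spot1
  | Sub e a b Step3 => Mid e a b Spot2
  | Sub e a b Step4 => Mid e a b Spot3
  end.

Fixpoint target (e : edge) : vertex :=
  match e with
  | Base t => Tip t
  | Sub e a b Step1 => Mid e a b Spot1
  | Sub e a b Step2 => Mid e a b Spot2
  | Sub e a b Step3 => Mid e a b Spot3
  | Sub e a b Step4 => target e
  end.

Definition fit (c a b x : S) : S := if `[< le c (join a b) >] then x else c.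

Fixpoint label (e : edge) : S :=
  match e with
  | Base t => t
  | Sub e a b (Step1 | Step3) => fit (label e) a b a
  | Sub e a b (Step2 | Step4) => fit (label e) a b b
  end.

(** This holds in both branches of [fit]. When a whole bypass collapses, its two ends therefore
    already agree, so the choice of [s] in [nf_mid] is harmless. *)
Lemma fit_ideal I c a b : ideal I -> I (fit c a b a) -> I (fit c a b b) -> I c.
Proof.
move=> HI; rewrite /fit; case: asboolP => // cab Ia Ib.
by apply: (ideal_down _ HI _ _ cab); apply: ideal_join.
Qed.

(* [nf I v] is a canonical representative of the component of [v] in the graph formed
   by the edges with label in [I]; [s] and [t] stand for the representatives of the
   ends of [e]. *)
Definition nf_mid (I : S -> Prop) (s t : vertex) e a b (k : spot) : vertex :=
  match `[< I (fit (label e) a b a) >], `[< I (fit (label e) a b b) >], k with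
  | true, true, _ => s
  | true, false, Spot1 => s
  | true, false, _ => Mid e a b Spot2
  | false, true, Spot3 => t
  | false, true, _ => Mid e a b Spot1
  | false, false, _ => Mid e a b k
  end.

Definition nf_tip (I : S -> Prop) (t : S) : vertex :=
  if `[< I t >] then Root else Tip t.

Fixpoint nf_ends (I : S -> Prop) (e : edge) : vertex * vertex :=
  match e with
  | Base t => (Root, nf_tip I t)
  | Sub e a b j =>
    let (s, t) := nf_ends I e in
    match j with
    | Step1 => (s, nf_mid I s t e a b Spot1)
    | Step2 => (nf_mid I s t e a b Spot1, nf_mid I s t e a b Spot2)
    | Step3 => (nf_mid I s t e a b Spot2, nf_mid I s t e a b Spot3)
    | Step4 => (nf_mid I s t e a b Spot3, t)
    end
  end.

Definition nf (I : S -> Prop) (v : vertex) : vertex :=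
  match v with
  | Root => Root
  | Tip t => nf_tip I t
  | Mid e a b k => let (s, t) := nf_ends I e in nf_mid I s t e a b k
  end.

Lemma nf_endsE I e : nf_ends I e = (nf I (source e), nf I (target e)).
Proof. by elim: e => //= e IH a b []; rewrite /= ?IH //= IH. Qed.

Lemma nf_MidE I e a b k :
  nf I (Mid e a b k) = nf_mid I (nf I (source e)) (nf I (target e)) e a b k.
Proof. by rewrite /= nf_endsE. Qed.

(** The kernel of [nf I] contains the edges with label in [I]; [nf_rel] shows that it is the least
    equivalence that does. *)
Lemma nf_edge I e : ideal I -> I (label e) -> nf I (source e) = nf I (target e).
Proof.
move=> HI; elim: e => [t It|e IH a b j].
  by rewrite /= /nf_tip asboolT.
have fitI := fit_ideal I (label e) a b HI.
by case: j; rewrite /source -/source /target -/target !nf_MidE /nf_mid /= => H;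
  rewrite ?(asboolT H) //; case: asboolP => // H'; rewrite -?IH //; exact: fitI.
Qed.

Fixpoint depth (e : edge) : nat :=
  match e with Base _ => 0 | Sub e _ _ _ => (depth e).+1 end.

Definition vdepth (v : vertex) : nat :=
  match v with Mid e _ _ _ => (depth e).+1 | _ => 0 end.

Lemma vdepth_ends e : vdepth (source e) <= depth e /\ vdepth (target e) <= depth e.
Proof. by elim: e => //= e [IH1 IH2] a b []; split=> //; apply: leqW. Qed.

Lemma vdepth_nf I v : vdepth (nf I v) <= vdepth v.
Proof.
have tip t : vdepth (nf_tip I t) <= 0 by rewrite /nf_tip; case: asboolP.
have mid s t e a b k : vdepth s <= depth e -> vdepth t <= depth e ->
    vdepth (nf_mid I s t e a b k) <= (depth e).+1.
  by rewrite /nf_mid => Hs Ht; case: asboolP; case: asboolP; case: k => //= _ _;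
    apply: leqW.
have ends e : vdepth (nf_ends I e).1 <= depth e /\ vdepth (nf_ends I e).2 <= depth e.
  elim: e => [t|e] //=; case: (nf_ends I e) => s t /= [Hs Ht] a b j.
  by case: j; split=> /=; do ?[exact: mid | exact: leqW].
case: v => //= e a b k; have := ends e.
by case: (nf_ends I e) => s t /= [Hs Ht]; exact: mid.
Qed.

Lemma nf_Mid_cases I e a b k :
  (exists k', nf I (Mid e a b k) = Mid e a b k') \/
  vdepth (nf I (Mid e a b k)) <= depth e.
Proof.
have [Hs Ht] := vdepth_ends e.
have {Hs} Hs := leq_trans (vdepth_nf I _) Hs.
have {Ht} Ht := leq_trans (vdepth_nf I _) Ht.
rewrite nf_MidE /nf_mid; case: asboolP => _; case: asboolP => _; case: k;
  do ?[by right | by left; eexists].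
Qed.

(** Normalising keeps an inner vertex in its own gadget or drops below the depth of that gadget, so
    it cannot enter another gadget that is at least as deep. *)
Lemma nf_avoid I v e a b k : vdepth v <= (depth e).+1 ->
  (forall k', v <> Mid e a b k') -> nf I v <> Mid e a b k.
Proof.
case: v => [|t|e' a' b' k'] // Hv nv.
- by rewrite /= /nf_tip; case: asboolP.
- have [[k'' ->] [? ? ? _]|Hd E] := nf_Mid_cases I e' a' b' k'.
    by apply: (nv k'); subst.
  by move: Hd; rewrite E /= => Hd; have := leq_trans Hd Hv; rewrite ltnn.
Qed.

Lemma nf_rel I (R : vertex -> vertex -> Prop) : ideal I -> is_equiv R ->
  (forall e, I (label e) -> R (source e) (target e)) -> forall v, R v (nf I v).
Proof.
move=> HI [Rr [Rs Rt]] RI.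
have tip t : R (Tip t) (nf_tip I t).
  by rewrite /nf_tip; case: asboolP => // It; apply: (Rs); exact: (RI (Base t)).
have mid e a b k : R (source e) (nf I (source e)) -> R (target e) (nf I (target e)) ->
    R (Mid e a b k) (nf I (Mid e a b k)).
  move=> Hs Ht.
  have := (RI (Sub e a b Step1), RI (Sub e a b Step2), RI (Sub e a b Step3),
           RI (Sub e a b Step4)).
  rewrite nf_MidE /nf_mid /=.
  case: asboolP => Ha; case: asboolP => Hb [[[R1 R2] R3] R4]; case: k => //; eauto 6.
  by apply: (Rt _ _ _ (Rs _ _ (R3 Ha))); eauto 6.
have ends e : R (source e) (nf I (source e)) /\ R (target e) (nf I (target e)).
  elim: e => [t|e [Hs Ht] a b j]; first by split=> //=; exact: tip.
  by case: j; split; do ?[exact: Hs | exact: Ht | exact: mid].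
by case=> [|t|e a b k] //; have [? ?] := ends e; exact: mid.
Qed.

Lemma ker_nf_equiv I : is_equiv (fun v w => nf I v = nf I w).
Proof. by split=> //; split=> [v w ->|u v w -> ->]. Qed.

Lemma nf_mono I J v w : ideal I -> ideal J -> (forall t, I t -> J t) ->
  nf I v = nf I w -> nf J v = nf J w.
Proof.
move=> HI HJ IJ E.
have H := nf_rel I _ HI (ker_nf_equiv J) (fun e Ie => nf_edge J e HJ (IJ _ Ie)).
by rewrite (H v) (H w) E.
Qed.

Lemma nf_idem I v : ideal I -> nf I (nf I v) = nf I v.
Proof.
move=> HI.
by rewrite -(nf_rel I _ HI (ker_nf_equiv I) (fun e Ie => nf_edge I e HI Ie)).
Qed.

(* Induction on the total depth: a vertex of the deepest gadget involved can be
   identified with a vertex outside it only through edges whose labels lie in the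
   ideal, hence, for both ideals, through edges whose labels lie in the intersection. *)
Lemma nf_meet I J v w : ideal I -> ideal J ->
  nf I v = nf I w -> nf J v = nf J w -> nf (ideal_meet I J) v = nf (ideal_meet I J) w.
Proof.
move=> HI HJ; have HK := ideal_meetP I J HI HJ.
set K := ideal_meet I J in HK *.
have [n] := ubnP (vdepth v + vdepth w); elim: n v w => // n IHn v w.
wlog wv : v w / vdepth w <= vdepth v.
  move=> H; have [/H//|/ltnW vw] := leqP (vdepth w) (vdepth v).
  by rewrite addnC => Hn EI EJ; symmetry; apply: H.
have tipE (L : S -> Prop) t : nf L (Tip t) = if `[< L t >] then Root else Tip t by [].
case: v wv => [|t|e a b k] wv Hn.
- case: w wv Hn => [|u|] // _ _; rewrite !tipE /=.
  by case: asboolP => // Iu _; case: asboolP => // Ju _; rewrite asboolT.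
- case: w wv Hn => [|u|] // _ _; rewrite !tipE /=.
    by case: asboolP => // It _; case: asboolP => // Jt _; rewrite asboolT.
  case: asboolP => It; case: asboolP => Iu // EI; last by case: EI => ->.
  by case: asboolP => Jt; case: asboolP => Ju // EJ;
    [rewrite !asboolT | case: EJ => ->].
have [Hs Ht] := vdepth_ends e.
have nfs L k' : nf L (source e) <> Mid e a b k'.
  by apply: nf_avoid; [exact: leqW | move=> k'' E; move: Hs; rewrite E /= ltnn].
have nft L k' : nf L (target e) <> Mid e a b k'.
  by apply: nf_avoid; [exact: leqW | move=> k'' E; move: Ht; rewrite E /= ltnn].
(* If both vertices belong to one gadget, a finite check of the cases of [nf_mid] suffices; [nfs]
   and [nft] exclude that an end is represented by an inner vertex. *)
have [[k' wE]|nw] := EM (exists k', w = Mid e a b k').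
  rewrite {}wE {w wv Hn} !nf_MidE /nf_mid.
  case: asboolP => Ia; case: asboolP => Ib; case: k; case: k' => // EI;
   do ?[by case: (nfs _ _ EI) | by case: (nfs _ _ (esym EI)) | by case: (nft _ _ EI)
      | by case: (nft _ _ (esym EI))];
   case: asboolP => Ja; case: asboolP => Jb // EJ;
   do ?[by case: (nfs _ _ EJ) | by case: (nfs _ _ (esym EJ)) | by case: (nft _ _ EJ)
      | by case: (nft _ _ (esym EJ))];
   case: asboolP => Ka; case: asboolP => Kb //; do ?[by case: Ka | by case: Kb].
have nfw L k' : nf L w <> Mid e a b k'.
  by apply: nf_avoid => // k'' E; apply: nw; exists k''.
(* [red] trades the deeper vertex for an end [u] of its gadget to which [I], [J] and [K] all connect
   it; the total depth drops. *)
have red u : vdepth u <= depth e -> nf I u = nf I (Mid e a b k) ->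
    nf J u = nf J (Mid e a b k) -> nf K u = nf K (Mid e a b k) ->
    nf I (Mid e a b k) = nf I w -> nf J (Mid e a b k) = nf J w ->
    nf K (Mid e a b k) = nf K w.
  move=> Hu uI uJ <- EI EJ; apply: IHn; rewrite ?uI ?uJ //.
  by apply: leq_ltn_trans (leq_add Hu (leqnn _)) _; rewrite -ltnS.
(* Since [w] is represented outside the gadget, the inner vertex must be as well, and this forces
   the labels on its way out into the ideal. *)
have needI L : nf L (Mid e a b k) = nf L w ->
    match k with
    | Spot1 => L (fit (label e) a b a)
    | Spot2 => L (fit (label e) a b a) /\ L (fit (label e) a b b)
    | Spot3 => L (fit (label e) a b b)
    end.
  rewrite nf_MidE /nf_mid; case: asboolP => ?; case: asboolP => ?; case: (k) => // E;
    by case: (nfw L _ (esym E)).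
move=> EI EJ; move: (needI _ EI) (needI _ EJ).
have toS L : ideal L -> match k with
    | Spot1 => L (fit (label e) a b a)
    | Spot2 => L (fit (label e) a b a) /\ L (fit (label e) a b b)
    | Spot3 => False
    end -> nf L (source e) = nf L (Mid e a b k).
  move=> HL; rewrite nf_MidE /nf_mid; case: (k) => //.
    by move=> La; rewrite (asboolT La); case: asboolP.
  by move=> [La Lb]; rewrite (asboolT La) (asboolT Lb).
have toT L : ideal L -> match k with
    | Spot3 => L (fit (label e) a b b) | _ => False
    end -> nf L (target e) = nf L (Mid e a b k).
  move=> HL; case E : k => // Lb.
  exact/esym/(nf_edge L (Sub e a b Step4)).
case E : k red toS toT EI EJ => red toS toT EI EJ.
- by move=> Ia Ja; apply: (red (source e)); rewrite ?toS //.
- by move=> [Ia Ib] [Ja Jb]; apply: (red (source e)); rewrite ?toS //; split.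
- by move=> Ib Jb; apply: (red (target e)); rewrite ?toT //.
Qed.

(** An edge whose label is below [join a b], with [a] in [I] and [b] in [J], can be replaced by its
    bypass, whose four edges lie alternately in [I] and [J]. *)
Lemma nf_sup I J (R : vertex -> vertex -> Prop) v w : ideal I -> ideal J -> is_equiv R ->
  (forall x y, nf I x = nf I y -> R x y) -> (forall x y, nf J x = nf J y -> R x y) ->
  nf (ideal_sup I J) v = nf (ideal_sup I J) w -> R v w.
Proof.
move=> HI HJ HR RI RJ E; have HK := ideal_supP I J HI HJ.
have {HR} [Rr [Rs Rt]] := HR.
have H x : R x (nf (ideal_sup I J) x).
  apply: nf_rel => // e [a [b [Ia Jb cab]]].
  have fitE y : fit (label e) a b y = y by rewrite /fit asboolT.
  have eI j := nf_edge I (Sub e a b j) HI; have eJ j := nf_edge J (Sub e a b j) HJ.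
  apply: (Rt _ (Mid e a b Spot1)).
    by apply/RI/(eI Step1); rewrite /= fitE.
  apply: (Rt _ (Mid e a b Spot2)).
    by apply/RJ/(eJ Step2); rewrite /= fitE.
  apply: (Rt _ (Mid e a b Spot3)).
    by apply/RI/(eI Step3); rewrite /= fitE.
  by apply/RJ/(eJ Step4); rewrite /= fitE.
by apply: (Rt _ _ _ (H v)); rewrite E; exact: Rs.
Qed.

Lemma nf_total v w : nf (fun _ => True) v = nf (fun _ => True) w.
Proof.
suff H u : nf (fun _ => True) u = Root by rewrite !H.
have T : `[< True >] = true by exact: asboolT.
have ends e : nf_ends (fun _ => True) e = (Root, Root).
  elim: e => [t|e IH a b j] /=; first by rewrite /nf_tip T.
  by rewrite IH /nf_mid !T; case: j.
by case: u => [|t|e a b k] //=; rewrite ?ends /nf_mid /nf_tip T.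
Qed.

(** * From components of the graph to equivalence relations on [O] *)

Section Representation.
Context {O : Type} (g : O -> vertex).
Hypothesis g_inj : forall p q, g p = g q -> p = q.
Hypothesis g_nf : forall p, nf ideal_bot (g p) = g p.
Hypothesis g_surj : forall v, nf ideal_bot v = v -> exists p, g p = v.

(* Vertices joined by edges of label zero must be identified for the representation to
   preserve zero, so [O] enumerates only the normal forms for [ideal_bot]. *)
Definition ideal_rep (I : S -> Prop) : EqRel O :=
  exist _ (fun p q => nf I (g p) = nf I (g q))
    (conj (fun _ => erefl) (conj (fun _ _ => @esym _ _ _) (fun _ _ _ => @etrans _ _ _ _))).

Lemma g_retract : exists r : vertex -> O, forall v, g (r v) = nf ideal_bot v.
Proof.
have /choice[r gr] : forall v, exists x, g x = nf ideal_bot v; last by exists r.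
by move=> v; apply: g_surj; apply: nf_idem; exact: ideal_botP.
Qed.

Lemma nf_bot I v : ideal I -> nf I (nf ideal_bot v) = nf I v.
Proof.
move=> HI; apply: (nf_mono _ _ _ _ ideal_botP HI (ideal_bot_sub I HI)).
by apply: nf_idem; exact: ideal_botP.
Qed.

Lemma ideal_rep_meet I J : ideal I -> ideal J ->
  ideal_rep (ideal_meet I J) = eq_meet (ideal_rep I) (ideal_rep J).
Proof.
move=> HI HJ; have HK := ideal_meetP I J HI HJ.
apply: EqRel_ext => p q; rewrite eq_meetE /=; split; last by case; exact: nf_meet.
by move=> E; split; apply: (nf_mono _ _ _ _ HK _ _ E) => // t [].
Qed.

Lemma ideal_rep_sup I J : ideal I -> ideal J ->
  ideal_rep (ideal_sup I J) = eq_join (ideal_rep I) (ideal_rep J).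
Proof.
move=> HI HJ; have HK := ideal_supP I J HI HJ.
apply: EqRel_ext => p q; split.
  have [r gr] := g_retract.
  have rg u : r (g u) = u by apply: g_inj; rewrite gr g_nf.
  have := proj2_sig (eq_join (ideal_rep I) (ideal_rep J)).
  set R := sval (eq_join _ _) => -[Rr [Rs Rt]].
  have RI L : ideal L -> (forall p q, nf L (g p) = nf L (g q) -> R p q) ->
      forall x y, nf L x = nf L y -> R (r x) (r y).
    by move=> HL LR x y E; apply: LR; rewrite !gr !nf_bot.
  move=> /= E; rewrite -(rg p) -(rg q).
  (* [R] lives on [O]; pulled back along the retraction [r] it becomes an equivalence on all
     vertices, as [nf_sup] requires. *)
  apply: (nf_sup I J (fun x y => R (r x) (r y))) => //.
  - by split=> //; split=> [x y|x y z]; [exact: Rs | exact: Rt].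
  - apply: RI => // {}p {}q {}E; apply/eq_joinE.
    by apply: t_step; left.
  - apply: RI => // {}p {}q {}E; apply/eq_joinE.
    by apply: t_step; right.
move/eq_joinE; elim=> {p q} [p q [E|E]|p q u _ E1 _ E2] /=.
- apply: (nf_mono I) => // t It; exists t, zero; split=> //; exact: ideal0.
- apply: (nf_mono J) => // t Jt; exists zero, t; split=> //; exact: ideal0.
- exact: etrans E1 E2.
Qed.

Lemma ideal_rep_bot : ideal_rep ideal_bot = eq_bot O.
Proof.
by apply: EqRel_ext => p q /=; rewrite !g_nf; split=> [/g_inj|->].
Qed.

Lemma ideal_rep_total : ideal_rep (fun _ => True) = eq_top O.
Proof. by apply: EqRel_ext => p q /=; split=> // _; exact: nf_total. Qed.

(** The base edges serve this purpose: [t] lies in [I] exactly when [I] connects [Tip t] to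
    [Root]. *)
Lemma ideal_rep_le I J : ideal I -> ideal J ->
  (forall p q, sval (ideal_rep I) p q -> sval (ideal_rep J) p q) ->
  forall t, I t -> J t.
Proof.
move=> HI HJ IJ t It; have [r gr] := g_retract.
have : sval (ideal_rep J) (r Root) (r (Tip t)).
  by apply: IJ; rewrite /= !gr !nf_bot //= /nf_tip asboolT.
by rewrite /= !gr !nf_bot //= /nf_tip; case: asboolP.
Qed.

End Representation.

(** * Counting the normal vertices by codes in [O] *)

Section Encoding.
Context {O : Type} (p : O -> O -> O) (c : nat -> O) (code : S -> O).
Hypothesis p_inj : pairing p.
Hypothesis c_inj : forall m n, c m = c n -> m = n.
Hypothesis code_inj : forall s t, code s = code t -> s = t.

Definition step_code (j : step) : nat :=
  match j with Step1 => 1 | Step2 => 2 | Step3 => 3 | Step4 => 4 end.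

Definition spot_code (k : spot) : nat :=
  match k with Spot1 => 2 | Spot2 => 3 | Spot3 => 4 end.

Fixpoint edge_code (e : edge) : O :=
  match e with
  | Base t => p (c 0) (code t)
  | Sub e a b j => p (c (step_code j)) (p (edge_code e) (p (code a) (code b)))
  end.

Definition vertex_code (v : vertex) : O :=
  match v with
  | Root => p (c 0) (c 0)
  | Tip t => p (c 1) (code t)
  | Mid e a b k => p (c (spot_code k)) (p (edge_code e) (p (code a) (code b)))
  end.

Lemma edge_code_inj e e' : edge_code e = edge_code e' -> e = e'.
Proof.
elim: e e' => [t|e IH a b j] [t'|e' a' b' j'] /= /p_inj[/c_inj].
- by move=> _ /code_inj ->.
- by case: j'.
- by case: j.
- move=> jj' /p_inj[/IH -> /p_inj[/code_inj -> /code_inj ->]].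
  by case: j jj'; case: j'.
Qed.

Lemma vertex_code_inj v v' : vertex_code v = vertex_code v' -> v = v'.
Proof.
case: v v' => [|t|e a b k] [|t'|e' a' b' k'] //= /p_inj[/c_inj] //;
  do ?[by case: k | by case: k'].
- by move=> _ /code_inj ->.
- move=> kk' /p_inj[/edge_code_inj -> /p_inj[/code_inj -> /code_inj ->]].
  by case: k kk'; case: k'.
Qed.

(** Cantor-Bernstein: [vertex_code] bounds the number of normal vertices from above, and the tips
    [Tip (d x)], normal because their labels are nonzero, bound it from below. *)
Lemma normal_vertex_enum (d : O -> S) :
  (forall x y, d x = d y -> x = y) -> (forall x, ~ le (d x) zero) ->
  exists g : O -> vertex,
    [/\ forall x y, g x = g y -> x = y, forall x, nf ideal_bot (g x) = g x &
        forall v, nf ideal_bot v = v -> exists x, g x = v].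
Proof.
move=> d_inj d_ne.
pose N : set vertex := [set v | nf ideal_bot v = v]%classic.
have ON : ([set: O] #<= N)%card.
  have [|f] := (@injfunPex _ _ [set: O]%classic N).2; last exact: inj_card_le.
  exists (fun x => Tip (d x)).
    by move=> x _; rewrite /N /= /nf_tip; case: asboolP => // /d_ne.
  by move=> x y _ _ [/d_inj].
have NO : (N #<= [set: O])%card.
  have [|f] := (@injfunPex _ _ N [set: O]%classic).2; last exact: inj_card_le.
  by exists vertex_code => // x y _ _ /vertex_code_inj.
have /card_bijP[f [h hK fK]] := Cantor_Bernstein ON NO.
pose i (x : O) : [set: O]%classic := SigSub (mem_set (I : [set: O]%classic x)).
exists (fun x => val (f (i x))); split.
- by move=> x y /val_inj/(can_inj hK)/(congr1 val).
- by move=> x; have /set_mem := valP (f (i x)).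
- move=> v Nv; pose w : N := SigSub (mem_set (Nv : N v)).
  exists (val (h w)); suff -> : i (val (h w)) = h w by rewrite fK.
  exact: val_inj.
Qed.

End Encoding.

End SemilatticeGraph.

(** * The word problem *)

Inductive term (A : Type) :=
| Gen (i : bool) (a : A)
| Meet (t s : term A)
| Join (t s : term A).
Arguments Gen {A} i a.
Arguments Meet {A} t s.
Arguments Join {A} t s.

Fixpoint term_map {A B : Type} (f : A -> B) (t : term A) : term B :=
  match t with
  | Gen i a => Gen i (f a)
  | Meet t s => Meet (term_map f t) (term_map f s)
  | Join t s => Join (term_map f t) (term_map f s)
  end.

Section WordProblem.
Context {O : Type}.
Local Notation L := (EqRel O).
Local Notation bot := (eq_bot O).
Implicit Types (a b c : L) (u v : option L) (t s r : term L) (i j : bool).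

(** An equivalence is seen as its set of pairs, and the added top as all pairs plus one extra point
    [None] that lies in no equivalence. The order becomes inclusion of point sets, so continuity of
    covers can be argued pointwise. *)
Definition omem u (w : option (O * O)) : Prop :=
  match u, w with
  | None, _ => True
  | Some _, None => False
  | Some a, Some (x, y) => sval a x y
  end.

Definition ole u v : Prop := forall w, omem u w -> omem v w.

Definition omeet u v : option L :=
  match u, v with
  | Some a, Some b => Some (eq_meet a b)
  | Some a, None => Some a
  | None, _ => v
  end.

Definition ojoin u v : option L :=
  match u, v with
  | Some a, Some b => Some (eq_join a b)
  | _, _ => None
  end.

Lemma ole_refl u : ole u u. Proof. by []. Qed.

Lemma ole_trans u v z : ole u v -> ole v z -> ole u z.
Proof. by move=> uv vz w /uv/vz. Qed.

Lemma ole_Some a b : ole (Some a) (Some b) <-> ele a b.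
Proof.
by split=> [ab x y|ab [[x y]|] //]; [exact: (ab (Some (x, y))) | exact: ab].
Qed.

Lemma ole_NoneF a : ~ ole None (Some a).
Proof. by move/(_ None); exact. Qed.

Lemma ole_None u : ole u None. Proof. by case: u. Qed.

Lemma bot_ole u : ole (Some bot) u.
Proof. by case: u => [a|]; [apply/ole_Some; exact: bot_ele | exact: ole_None]. Qed.

Lemma omem_meet u v w : omem (omeet u v) w <-> omem u w /\ omem v w.
Proof. by case: u v w => [a|] [b|] [[x y]|]; rewrite /= ?eq_meetE; tauto. Qed.

Lemma omeet_mono u v u' v' : ole u u' -> ole v v' -> ole (omeet u v) (omeet u' v').
Proof. by move=> uu' vv' w /omem_meet[/uu' ? /vv' ?]; apply/omem_meet. Qed.

Lemma ole_joinl u v : ole u (ojoin u v).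
Proof.
by case: u v => [a|] [b|] //; do ?exact: ole_None; apply/ole_Some; exact: ele_joinl.
Qed.

Lemma ole_joinr u v : ole v (ojoin u v).
Proof.
by case: u v => [a|] [b|] //; do ?exact: ole_None; apply/ole_Some; exact: ele_joinr.
Qed.

Lemma ojoin_le u v z : ole u z -> ole v z -> ole (ojoin u v) z.
Proof.
case: z => [c|]; last by move=> _ _; exact: ole_None.
case: u v => [a|] [b|]; do ?by move=> // /ole_NoneF; do ?by move=> _ /ole_NoneF.
by move=> /ole_Some ac /ole_Some bc; apply/ole_Some; exact: join_ele.
Qed.

Lemma ojoin_mono u v u' v' : ole u u' -> ole v v' -> ole (ojoin u v) (ojoin u' v').
Proof.
by move=> uu' vv'; apply: ojoin_le;
  [apply: ole_trans uu' _; exact: ole_joinl | apply: ole_trans vv' _; exact: ole_joinr].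
Qed.

(* [up t i] is the least element of the [i]-th factor above [t], with [None] for an added
   top, and [lo t i] is the greatest element of that factor below [t].  A term with a
   vanishing upper cover in one factor is zero, so [clamp] makes both of its covers
   vanish; without this, [tle] would not be transitive. *)
Definition vanishing (f : bool -> option L) : Prop := exists j, ole (f j) (Some bot).

Definition clamp (f : bool -> option L) (i : bool) : option L :=
  if `[< vanishing f >] then Some bot else f i.

Lemma clamp_le f i : ole (clamp f i) (f i).
Proof. by rewrite /clamp; case: asboolP => _; [exact: bot_ole | exact: ole_refl]. Qed.

Lemma clamp_bot f i : vanishing f -> clamp f i = Some bot.
Proof. by rewrite /clamp => /asboolT ->. Qed.

Lemma clampN f i : ~ vanishing f -> clamp f i = f i.
Proof. by rewrite /clamp => /asboolF ->. Qed.

Lemma le_clamp f h i : (forall j, ole (f j) (h j)) ->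
  (vanishing f -> ole (f i) (Some bot)) -> ole (f i) (clamp h i).
Proof.
move=> fh f0; have [hv|/clampN ->] := EM (vanishing h); last exact: fh.
rewrite clamp_bot //; apply: f0; case: hv => j hj; exists j.
exact: ole_trans (fh j) hj.
Qed.

Lemma clamp_coherent f i j : ole (clamp f j) (Some bot) -> ole (clamp f i) (Some bot).
Proof.
have [fv _|fN] := EM (vanishing f); first by rewrite clamp_bot.
by rewrite (clampN _ _ fN) => fj; case: fN; exists j.
Qed.

Fixpoint up t : bool -> option L :=
  match t with
  | Gen j a => clamp (fun i => if i == j then Some a else None)
  | Meet t s => clamp (fun i => omeet (up t i) (up s i))
  | Join t s => fun i => ojoin (up t i) (up s i)
  end.

Fixpoint lo t (i : bool) : L :=
  match t with
  | Gen j a => if i == j then a else bot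
  | Meet t s => eq_meet (lo t i) (lo s i)
  | Join t s => eq_join (lo t i) (lo s i)
  end.

(** In [tle_cover] an element of one factor lies between the two terms; this rule subsumes the
    comparison of generators. Transitivity is not a rule, so a derivation ends in one of finitely
    many ways, as the pigeonhole argument needs. *)
Inductive tle : term L -> term L -> Prop :=
| tle_cover i t s : ole (up t i) (Some (lo s i)) -> tle t s
| tle_joinL t1 t2 s : tle t1 s -> tle t2 s -> tle (Join t1 t2) s
| tle_meetL1 t1 t2 s : tle t1 s -> tle (Meet t1 t2) s
| tle_meetL2 t1 t2 s : tle t2 s -> tle (Meet t1 t2) s
| tle_meetR t s1 s2 : tle t s1 -> tle t s2 -> tle t (Meet s1 s2)
| tle_joinR1 t s1 s2 : tle t s1 -> tle t (Join s1 s2)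
| tle_joinR2 t s1 s2 : tle t s2 -> tle t (Join s1 s2).

Lemma up_coherent t i j : ole (up t j) (Some bot) -> ole (up t i) (Some bot).
Proof.
elim: t => [k a|t _ s _|t IHt s IHs] /=; try exact: clamp_coherent.
move=> H; apply: ojoin_le; [apply: IHt | apply: IHs]; apply: ole_trans H.
  exact: ole_joinl.
exact: ole_joinr.
Qed.

(** The second half says that no term lies between a nonzero element of one factor and an element of
    the other. The halves are proved together: when a cover of a meet vanishes in factor [j], its
    lower cover in [i] vanishes by the first half if [i = j] and by the second otherwise. *)
Lemma lo_up_all t : (forall i, ole (Some (lo t i)) (up t i)) /\
  (forall i j, i != j -> up t j = None \/ ele (lo t i) bot).
Proof.
elim: t => [k a|t [IHt IHt'] s [IHs IHs']|t [IHt IHt'] s [IHs IHs']] /=.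
- pose f i := if i == k then Some a else None.
  have fv : vanishing f -> ele a bot.
    by case=> j; rewrite /f; case: eqP => _; [move/ole_Some | move/ole_NoneF].
  have [/[dup] /fv a0 fV|fN] := EM (vanishing f).
    have H i : ele (if i == k then a else bot) bot by case: eqP => _ //; exact: ele_refl.
    split=> [i|i j _]; last by right.
    by apply: ole_trans (bot_ole _); apply/ole_Some.
  split=> [i|i j ij]; rewrite clampN // /f.
    by case: eqP => _; [exact: ole_refl | exact: bot_ole].
  have [ik|ik] := eqVneq i k; last by right.
  by left; move: ij; rewrite ik eq_sym => /negbTE ->.
- pose f i := omeet (up t i) (up s i).
  have lo_f i : ole (Some (eq_meet (lo t i) (lo s i))) (f i).
    by apply: (omeet_mono (Some _) (Some _)).
  have other i j : i != j -> f j = None \/ ele (eq_meet (lo t i) (lo s i)) bot.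
    rewrite /f => ij; case: (IHt' _ _ ij) => [->|Ht]; last first.
      by right; apply: ele_trans (meet_elel _ _) Ht.
    case: (IHs' _ _ ij) => [->|Hs]; first by left.
    by right; apply: ele_trans (meet_eler _ _) Hs.
  have fv i : vanishing f -> ele (eq_meet (lo t i) (lo s i)) bot.
    move=> [j fj]; have [ij|ij] := eqVneq i j.
      by subst j; apply/ole_Some; exact: ole_trans (lo_f i) fj.
    by case: (other _ _ ij) => // fN; move: fj; rewrite fN => /ole_NoneF.
  have [fV|fN] := EM (vanishing f).
    split=> [i|i j _]; last by right; exact: fv.
    by apply: ole_trans (bot_ole _); apply/ole_Some; exact: fv.
  by split=> [i|i j ij]; rewrite clampN //; exact: other.
- split=> [i|i j ij]; first exact: (ojoin_mono (Some _) (Some _)).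
  case: (IHt' _ _ ij) => [->|Ht]; first by left.
  case: (IHs' _ _ ij) => [->|Hs]; first by left; case: (up t j).
  by right; apply: join_ele.
Qed.

Lemma lo_up t i : ole (Some (lo t i)) (up t i).
Proof. by have [] := lo_up_all t. Qed.

Lemma lo_up_other t i j : i != j -> up t j = None \/ ele (lo t i) bot.
Proof. by have [_] := lo_up_all t; exact. Qed.

Lemma up_mono t s i : tle t s -> ole (up t i) (up s i).
Proof.
move=> H; elim: H i => {t s}
  [k t s Hk|t1 t2 s _ IH1 _ IH2|t1 t2 s _ IH|t1 t2 s _ IH|t s1 s2 _ IH1 _ IH2|
   t s1 s2 _ IH|t s1 s2 _ IH] i /=.
- have [->|ki] := eqVneq i k; first exact: ole_trans Hk (lo_up _ _).
  (* Either [s] has only the added top above it in factor [i], or [lo s k] is zero; then [up t k]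
     vanishes and coherence carries this over to factor [i]. *)
  have [->|s0] := lo_up_other s k i (contra_neq (@esym _ _ _) ki); first exact: ole_None.
  apply: ole_trans (bot_ole _); apply: (up_coherent _ _ k).
  by apply: ole_trans Hk _; apply/ole_Some.
- exact: ojoin_le.
- by apply: ole_trans (clamp_le _ _) _ => w /omem_meet[/IH].
- by apply: ole_trans (clamp_le _ _) _ => w /omem_meet[_ /IH].
- apply: le_clamp => [j w tw|[j /up_coherent]]; last exact.
  by apply/omem_meet; split; [exact: IH1 | exact: IH2].
- by apply: ole_trans (IH i) _; exact: ole_joinl.
- by apply: ole_trans (IH i) _; exact: ole_joinr.
Qed.

Lemma lo_mono t s i : tle t s -> ele (lo t i) (lo s i).
Proof.
move=> H; elim: H i => {t s}
  [k t s Hk|t1 t2 s _ IH1 _ IH2|t1 t2 s _ IH|t1 t2 s _ IH|t s1 s2 _ IH1 _ IH2|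
   t s1 s2 _ IH|t s1 s2 _ IH] i /=.
- have [->|ik] := eqVneq i k; first by apply/ole_Some; exact: ole_trans (lo_up _ _) Hk.
  have [tN|t0] := lo_up_other t i k ik; last exact: ele_trans t0 (bot_ele _).
  by move: Hk; rewrite tN => /ole_NoneF.
- exact: join_ele.
- exact: ele_trans (meet_elel _ _) (IH i).
- exact: ele_trans (meet_eler _ _) (IH i).
- exact: ele_meet.
- exact: ele_trans (IH i) (ele_joinl _ _).
- exact: ele_trans (IH i) (ele_joinr _ _).
Qed.

Lemma tle_refl t : tle t t.
Proof.
elim: t => [i a|t IHt s IHs|t IHt s IHs].
- by apply: (tle_cover i); rewrite /= eqxx; apply: ole_trans (clamp_le _ _) _; rewrite eqxx.
- by apply: tle_meetR; [exact: tle_meetL1 | exact: tle_meetL2].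
- by apply: tle_joinL; [exact: tle_joinR1 | exact: tle_joinR2].
Qed.

(** Cut elimination: induction on the middle term, then on the left derivation and, where that ends
    with a rule introducing the middle term, on the right one. A cover rule absorbs the other
    derivation through [lo_mono] or [up_mono]. *)
Lemma tle_trans s t r : tle t s -> tle s r -> tle t r.
Proof.
elim: s t r => [k a|s1 IH1 s2 IH2|s1 IH1 s2 IH2] t r Hts.
- move E : (Gen k a) Hts => s Hts; elim: Hts r E => {t s}
    [i t s H|t1 t2 s _ IHa _ IHb|t1 t2 s _ IH|t1 t2 s _ IH|//|//|//] r E Hsr.
  + by apply: (tle_cover i); apply: ole_trans H _; apply/ole_Some/lo_mono.
  + by apply: tle_joinL; [exact: IHa | exact: IHb].
  + by apply: tle_meetL1; exact: IH.
  + by apply: tle_meetL2; exact: IH.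
- move E : (Meet s1 s2) Hts => s Hts; elim: Hts r E => {t s}
    [i t s H|t1 t2 s _ IHa _ IHb|t1 t2 s _ IH|t1 t2 s _ IH|t u1 u2 H1 _ H2 _|//|//] r E Hsr.
  + by apply: (tle_cover i); apply: ole_trans H _; apply/ole_Some/lo_mono.
  + by apply: tle_joinL; [exact: IHa | exact: IHb].
  + by apply: tle_meetL1; exact: IH.
  + by apply: tle_meetL2; exact: IH.
  + case: E => ? ?; subst u1 u2.
    have up_t i := up_mono _ _ i (tle_meetR _ _ _ H1 H2).
    move E : (Meet s1 s2) Hsr up_t => s Hsr; elim: Hsr E => {s r}
      [i s r H|//|u1 u2 r H _|u1 u2 r H _|s r1 r2 _ IHa _ IHb|s r1 r2 _ IH|s r1 r2 _ IH]
      E up_t.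
    * by apply: (tle_cover i); exact: ole_trans (up_t i) H.
    * by case: E H => <- _; exact: IH1.
    * by case: E H => _ <-; exact: IH2.
    * by apply: tle_meetR; [exact: IHa | exact: IHb].
    * by apply: tle_joinR1; exact: IH.
    * by apply: tle_joinR2; exact: IH.
- move E : (Join s1 s2) Hts => s Hts; elim: Hts r E => {t s}
    [i t s H|t1 t2 s _ IHa _ IHb|t1 t2 s _ IH|t1 t2 s _ IH|//|t u1 u2 H _|t u1 u2 H _] r E Hsr.
  + by apply: (tle_cover i); apply: ole_trans H _; apply/ole_Some/lo_mono.
  + by apply: tle_joinL; [exact: IHa | exact: IHb].
  + by apply: tle_meetL1; exact: IH.
  + by apply: tle_meetL2; exact: IH.
  + case: E => ? ?; subst u1 u2.
    have up_t i := up_mono _ _ i (tle_joinR1 _ _ s2 H).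
    move E : (Join s1 s2) Hsr up_t => s Hsr; elim: Hsr E => {s r}
      [i s r Hi|u1 u2 r H1 _ _ _|//|//|s r1 r2 _ IHa _ IHb|s r1 r2 _ IHr|s r1 r2 _ IHr] E up_t.
    * by apply: (tle_cover i); exact: ole_trans (up_t i) Hi.
    * by case: E H1 => <- _; exact: IH1.
    * by apply: tle_meetR; [exact: IHa | exact: IHb].
    * by apply: tle_joinR1; exact: IHr.
    * by apply: tle_joinR2; exact: IHr.
  + case: E => ? ?; subst u1 u2.
    have up_t i := up_mono _ _ i (tle_joinR2 _ s1 _ H).
    move E : (Join s1 s2) Hsr up_t => s Hsr; elim: Hsr E => {s r}
      [i s r Hi|u1 u2 r _ _ H2 _|//|//|s r1 r2 _ IHa _ IHb|s r1 r2 _ IHr|s r1 r2 _ IHr] E up_t.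
    * by apply: (tle_cover i); exact: ole_trans (up_t i) Hi.
    * by case: E H2 => _ <-; exact: IH2.
    * by apply: tle_meetR; [exact: IHa | exact: IHb].
    * by apply: tle_joinR1; exact: IHr.
    * by apply: tle_joinR2; exact: IHr.
Qed.

Lemma tle_bot i a t : ele a bot -> tle (Gen i a) t.
Proof.
move=> a0; apply: (tle_cover i); apply: ole_trans (clamp_le _ _) _.
by rewrite eqxx; apply: ole_trans (bot_ole _); apply/ole_Some.
Qed.

Lemma tle_Gen i a b : ele a b -> tle (Gen i a) (Gen i b).
Proof.
move=> ab; apply: (tle_cover i); apply: ole_trans (clamp_le _ _) _.
by rewrite /= eqxx; apply/ole_Some.
Qed.

Lemma tle_Gen_meet i a b : tle (Meet (Gen i a) (Gen i b)) (Gen i (eq_meet a b)).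
Proof.
apply: (tle_cover i); rewrite /= eqxx; apply: ole_trans (clamp_le _ _) _.
have H c : ole (clamp (fun j => if j == i then Some c else None) i) (Some c).
  by apply: ole_trans (clamp_le _ _) _; rewrite eqxx.
exact: (omeet_mono _ _ (Some a) (Some b)).
Qed.

Lemma tle_Gen_join i a b : tle (Gen i (eq_join a b)) (Join (Gen i a) (Gen i b)).
Proof.
by apply: (tle_cover i); rewrite /= eqxx; apply: ole_trans (clamp_le _ _) _; rewrite eqxx.
Qed.

End WordProblem.

(** * Finitely generated approximations *)

Section Approximation.
Context {O : Type}.
Local Notation L := (EqRel O).
Local Notation bot := (eq_bot O).
Implicit Types (a b c : L) (t s r u : term L) (i j : bool).

Fixpoint compact (t : term L) : Prop :=
  match t with
  | Gen _ a => fg a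
  | Meet t s | Join t s => compact t /\ compact s
  end.

Fixpoint leafwise (t s : term L) : Prop :=
  match t, s with
  | Gen i a, Gen j b => i = j /\ ele a b
  | Meet t1 t2, Meet s1 s2 | Join t1 t2, Join s1 s2 => leafwise t1 s1 /\ leafwise t2 s2
  | _, _ => False
  end.

Definition approx (t s : term L) : Prop := compact t /\ leafwise t s.

Lemma leafwise_tle t s : leafwise t s -> tle t s.
Proof.
elim: t s => [i a|t1 IH1 t2 IH2|t1 IH1 t2 IH2] [j b|s1 s2|s1 s2] //=.
- by move=> [<-]; exact: tle_Gen.
- by move=> [/IH1 ? /IH2 ?]; apply: tle_meetR; [exact: tle_meetL1 | exact: tle_meetL2].
- by move=> [/IH1 ? /IH2 ?]; apply: tle_joinL; [exact: tle_joinR1 | exact: tle_joinR2].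
Qed.

Lemma approx_exists t : exists t', approx t' t.
Proof.
elim: t => [i a|t [t' [? ?]] s [s' [? ?]]|t [t' [? ?]] s [s' [? ?]]].
- by exists (Gen i bot); split; [exact: fg_bot | split=> //; exact: bot_ele].
- by exists (Meet t' s').
- by exists (Join t' s').
Qed.

Lemma approx_directed t t1 t2 : approx t1 t -> approx t2 t ->
  exists t3, [/\ approx t3 t, leafwise t1 t3 & leafwise t2 t3].
Proof.
elim: t t1 t2 => [i a|t IHt s IHs|t IHt s IHs].
- move=> [i1 a1|? ?|? ?] [i2 a2|? ?|? ?] [] //= f1 [-> a1a] [] //= f2 [-> a2a].
  exists (Gen i (eq_join a1 a2)); split; first split=> /=.
  + exact: fg_join.
  + by split=> //; exact: join_ele.
  + by split=> //; exact: ele_joinl.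
  + by split=> //; exact: ele_joinr.
- move=> [? ?|t1 s1|? ?] [? ?|t2 s2|? ?] [] //= [ct1 cs1] [tt1 ss1] [] //= [ct2 cs2] [tt2 ss2].
  have [t3 [[? ?] ? ?]] := IHt t1 t2 (conj ct1 tt1) (conj ct2 tt2).
  have [s3 [[? ?] ? ?]] := IHs s1 s2 (conj cs1 ss1) (conj cs2 ss2).
  by exists (Meet t3 s3); split.
- move=> [? ?|? ?|t1 s1] [? ?|? ?|t2 s2] [] //= [ct1 cs1] [tt1 ss1] [] //= [ct2 cs2] [tt2 ss2].
  have [t3 [[? ?] ? ?]] := IHt t1 t2 (conj ct1 tt1) (conj ct2 tt2).
  have [s3 [[? ?] ? ?]] := IHs s1 s2 (conj cs1 ss1) (conj cs2 ss2).
  by exists (Join t3 s3); split.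
Qed.

Lemma approx_Meet t s t' s' : approx t' t -> approx s' s -> approx (Meet t' s') (Meet t s).
Proof. by move=> [? ?] [? ?]. Qed.

Lemma approx_Join t s t' s' : approx t' t -> approx s' s -> approx (Join t' s') (Join t s).
Proof. by move=> [? ?] [? ?]. Qed.

Lemma lo_approx t i c : fg c -> ele c (lo t i) ->
  exists t', approx t' t /\ ele c (lo t' i).
Proof.
elim: t c => [k a|t IHt s IHs|t IHt s IHs] c fc /=.
- case: eqP => ik ca.
    exists (Gen k c); split; first by [].
    by rewrite /= ik eqxx; exact: ele_refl.
  have [t' t'a] := approx_exists (Gen k a); exists t'; split=> //.
  exact: ele_trans ca (bot_ele _).
- move=> cts; have [t' [? ?]] := IHt _ fc (ele_trans _ _ _ cts (meet_elel _ _)).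
  have [s' [? ?]] := IHs _ fc (ele_trans _ _ _ cts (meet_eler _ _)).
  by exists (Meet t' s'); split; [exact: approx_Meet | exact: ele_meet].
- move=> /fg_ele_join-/(_ fc)[a [b [fa fb /(IHt _ fa)[t' [? ?]] /(IHs _ fb)[s' [? ?]] cab]]].
  exists (Join t' s'); split; first exact: approx_Join.
  by apply: ele_trans cab _; exact: join_mono.
Qed.

Lemma up_fg t i a : compact t -> up t i = Some a -> fg a.
Proof.
have clamp_fg (f : bool -> option L) j b : (forall c, f j = Some c -> fg c) ->
    clamp f j = Some b -> fg b.
  by move=> H; rewrite /clamp; case: asboolP => _; [move=> [<-]; exact: fg_bot | exact: H].
elim: t i a => [k b|t IHt s IHs|t IHt s IHs] i a /=.
- by move=> fb; apply: clamp_fg => c; case: eqP => // _ [<-].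
- move=> [ct cs]; apply: clamp_fg => c.
  case Et: (up t i) => [d|]; case Es: (up s i) => [e|] //= [<-].
  + by apply: (fg_ele _ d); [exact: IHt Et | exact: meet_elel].
  + exact: IHt Et.
  + exact: IHs Es.
- move=> [ct cs]; case Et: (up t i) => [d|]; case Es: (up s i) => [e|] //= [<-].
  by apply: fg_join; [exact: IHt Et | exact: IHs Es].
Qed.

(** A derivation uses the labels of [t] only through lower covers, and the covers of [u] compared
    with them are finitely generated, so finitely generated labels in [t] suffice. This makes
    [below] preserve joins. *)
Lemma tle_approx u t : compact u -> tle u t -> exists t', approx t' t /\ tle u t'.
Proof.
move=> + H; elim: H => {u t}
  [i t s H ct|t1 t2 s _ IH1 _ IH2 /= [c1 c2]|t1 t2 s _ IH /= [c1 c2]|t1 t2 s _ IH /= [c1 c2]|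
   t s1 s2 _ IH1 _ IH2 ct|t s1 s2 _ IH ct|t s1 s2 _ IH ct].
- case E : (up t i) H => [a|] H; last by case: (ole_NoneF _ H).
  move: H => /ole_Some/(lo_approx _ _ _ (up_fg _ _ _ ct E))[s' [? as']].
  by exists s'; split=> //; apply: (tle_cover i); rewrite E; apply/ole_Some.
- have [s1 [sa1 ts1]] := IH1 c1; have [s2 [sa2 ts2]] := IH2 c2.
  have [s3 [? /leafwise_tle s13 /leafwise_tle s23]] := approx_directed _ _ _ sa1 sa2.
  by exists s3; split=> //; apply: tle_joinL;
    [exact: tle_trans ts1 s13 | exact: tle_trans ts2 s23].
- by have [s' [? ?]] := IH c1; exists s'; split=> //; exact: tle_meetL1.
- by have [s' [? ?]] := IH c2; exists s'; split=> //; exact: tle_meetL2.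
- have [t1 [? ?]] := IH1 ct; have [t2 [? ?]] := IH2 ct.
  by exists (Meet t1 t2); split; [exact: approx_Meet | exact: tle_meetR].
- have [t1 [? ?]] := IH ct; have [t2 ?] := approx_exists s2.
  by exists (Join t1 t2); split; [exact: approx_Join | exact: tle_joinR1].
- have [t2 [? ?]] := IH ct; have [t1 ?] := approx_exists s1.
  by exists (Join t1 t2); split; [exact: approx_Join | exact: tle_joinR2].
Qed.

(* Vanishing of one of the two covers is detected by finitely many pairs, because
   its negation is witnessed by one element of each cover. *)
Lemma clamp_continuous (K : Type) (D : K -> Prop) (F : K -> bool -> option L)
    (f : bool -> option L) i w : (exists k, D k) ->
  (forall k1 k2, D k1 -> D k2 -> exists k3, [/\ D k3, forall j, ole (F k1 j) (F k3 j) &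
    forall j, ole (F k2 j) (F k3 j)]) ->
  (forall j w', omem (f j) w' -> exists k, D k /\ omem (F k j) w') ->
  omem (clamp f i) w -> exists k, D k /\ omem (clamp (F k) i) w.
Proof.
move=> [k0 Dk0] dir cont; rewrite {1}/clamp; case: asboolP => [_ H|nv].
  by exists k0; split=> //; exact: (bot_ole _ _ H).
have wit j : exists wj, omem (f j) wj /\ ~ omem (Some bot) wj.
  apply: contrapT => H; apply: nv; exists j => w' fw'.
  by apply: contrapT => nw'; apply: H; exists w'.
have [w1 [/cont[k1 [D1 F1]] n1]] := wit true.
have [w2 [/cont[k2 [D2 F2]] n2]] := wit false.
move=> /cont[k3 [D3 F3]].
have [k4 [D4 H14 H24]] := dir _ _ D1 D2; have [k5 [D5 H35 H45]] := dir _ _ D3 D4.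
exists k5; split=> //; rewrite clampN; first exact: H35.
by move=> [[] H]; [apply/n1/H/H45/H14 | apply/n2/H/H45/H24].
Qed.

(** A point of a meet needs one approximation on each side, a point of a join only a finite chain;
    directedness merges them. This lets the cover rule pass from all approximations of [t] to
    [t]. *)
Lemma up_continuous t i w : omem (up t i) w -> exists t', approx t' t /\ omem (up t' i) w.
Proof.
elim: t i w => [k a|t IHt s IHs|t IHt s IHs] i w.
- pose F b j := if j == k then Some b else None : option L.
  move=> Hw; have [|b1 b2 [f1 a1] [f2 a2]|j w' H||b [[fb ba] H]] :=
      @clamp_continuous L (fun b => fg b /\ ele b a) F (F a) i w.
  + by exists bot; split; [exact: fg_bot | exact: bot_ele].
  + exists (eq_join b1 b2); split; first by split; [exact: fg_join | exact: join_ele].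
      by move=> j; rewrite /F; case: eqP => // _; apply/ole_Some; exact: ele_joinl.
    by move=> j; rewrite /F; case: eqP => // _; apply/ole_Some; exact: ele_joinr.
  + move: H; rewrite /F; case: eqP => _; last first.
      by exists bot; split=> //; split; [exact: fg_bot | exact: bot_ele].
    case: w' => [[x y]|] // axy; exists (gen ((x, y) :: nil)); split.
      by split; [eexists | apply: gen_ele => _ _ [[<- <-]|[]]].
    by apply: gen_in; left.
  + exact: Hw.
  + by exists (Gen k b).
- pose D (ts : term L * term L) := approx ts.1 t /\ approx ts.2 s.
  pose F (ts : term L * term L) j := omeet (up ts.1 j) (up ts.2 j).
  move=> H; have [|[t1 s1] [t2 s2] [/= ta1 sa1] [/= ta2 sa2]|j w' /omem_meet[]||
      [t' s'] [[? ?] ?]] :=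
      @clamp_continuous _ D F (fun j => omeet (up t j) (up s j)) i w.
  + have [t' ?] := approx_exists t; have [s' ?] := approx_exists s.
    by exists (t', s').
  + have [t3 [? /leafwise_tle t13 /leafwise_tle t23]] := approx_directed _ _ _ ta1 ta2.
    have [s3 [? /leafwise_tle s13 /leafwise_tle s23]] := approx_directed _ _ _ sa1 sa2.
    by exists (t3, s3); split=> // j; apply: omeet_mono; exact: up_mono.
  + move=> /IHt[t' [? ?]] /IHs[s' [? ?]]; exists (t', s'); split=> //.
    exact/omem_meet.
  + exact: H.
  + by exists (Meet t' s'); split; [exact: approx_Meet |].
- pose P w := exists r, approx r (Join t s) /\ omem (up r i) w.
  have inl w' : omem (up t i) w' -> P w'.
    move=> /IHt[t' [? H]]; have [s' ?] := approx_exists s.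
    by exists (Join t' s'); split; [exact: approx_Join | exact: ole_joinl].
  have inr w' : omem (up s i) w' -> P w'.
    move=> /IHs[s' [? H]]; have [t' ?] := approx_exists t.
    by exists (Join t' s'); split; [exact: approx_Join | exact: ole_joinr].
  rewrite /=; case Et : (up t i) => [a|]; last by move=> _; apply: inl; rewrite Et.
  case Es : (up s i) => [b|]; last by move=> _; apply: inr; rewrite Es.
  case: w => [[x y]|] // /eq_joinE; elim=> {x y} [x y [H|H]|x y z _ [r1 [ra1 H1]] _ [r2 [ra2 H2]]].
  + by apply: inl; rewrite Et.
  + by apply: inr; rewrite Es.
  + have [r [ra /leafwise_tle r1r /leafwise_tle r2r]] := approx_directed _ _ _ ra1 ra2.
    exists r; split=> //; move: (up_mono _ _ i r1r _ H1) (up_mono _ _ i r2r _ H2).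
    by case: (up r i) => [c|] //=; exact: EqRel_trans.
Qed.

Definition leafwise_closed (P : term L -> Prop) : Prop :=
  forall u u', leafwise u u' -> P u' -> P u.

Lemma leafwise_closed_or P Q : leafwise_closed P -> leafwise_closed Q ->
  leafwise_closed (fun u => P u \/ Q u).
Proof. by move=> HP HQ u u' uu' [/(HP _ _ uu')|/(HQ _ _ uu')]; [left|right]. Qed.

Lemma leafwise_closed_tle s : leafwise_closed (fun u => tle u s).
Proof. by move=> u u' /leafwise_tle; exact: tle_trans. Qed.

Lemma leafwise_closed_cover i a : leafwise_closed (fun u => ole (up u i) (Some a)).
Proof. by move=> u u' /leafwise_tle uu'; apply: ole_trans; exact: up_mono. Qed.

(** If [P] failed at [u1] and [Q] at [u2], an approximation above both would satisfy neither. *)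
Lemma approx_pigeonhole t (P Q : term L -> Prop) :
  leafwise_closed P -> leafwise_closed Q -> (forall u, approx u t -> P u \/ Q u) ->
  (forall u, approx u t -> P u) \/ (forall u, approx u t -> Q u).
Proof.
move=> Pd Qd PQ; have [|nP] := EM (forall u, approx u t -> P u); first by left.
right=> u2 a2; apply: contrapT => nQ2; apply: nP => u1 a1.
have [u3 [a3 u13 u23]] := approx_directed _ _ _ a1 a2.
by case: (PQ _ a3) => [/(Pd _ _ u13)|/(Qd _ _ u23)].
Qed.

(** The premise of a left meet rule as a predicate of the whole term, the form to which the
    pigeonhole applies. *)
Definition left_part (P : term L -> Prop) t : Prop :=
  if t is Meet t1 _ then P t1 else False.

Definition right_part (P : term L -> Prop) t : Prop :=
  if t is Meet _ t2 then P t2 else False.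

Lemma leafwise_closed_left P : leafwise_closed P -> leafwise_closed (left_part P).
Proof. by move=> HP [? ?|u1 u2|? ?] [? ?|v1 v2|? ?] //= [+ _]; exact: HP. Qed.

Lemma leafwise_closed_right P : leafwise_closed P -> leafwise_closed (right_part P).
Proof. by move=> HP [? ?|u1 u2|? ?] [? ?|v1 v2|? ?] //= [_ +]; exact: HP. Qed.

Definition join_parts (t s : term L) : Prop :=
  if s is Join s1 s2 then tle t s1 \/ tle t s2 else False.

Lemma leafwise_closed_join_parts s : leafwise_closed (fun t => join_parts t s).
Proof.
by case: s => [i a|s1 s2|s1 s2] //; apply: leafwise_closed_or; exact: leafwise_closed_tle.
Qed.

Definition is_join t : bool := if t is Join _ _ then true else false.
Definition is_meet t : bool := if t is Meet _ _ then true else false.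

Lemma tle_inv t s : ~~ is_join t -> ~~ is_meet s -> tle t s ->
  (ole (up t true) (Some (lo s true)) \/ ole (up t false) (Some (lo s false))) \/
  ((left_part (fun t1 => tle t1 s) t \/ right_part (fun t2 => tle t2 s) t) \/
   join_parts t s).
Proof.
move=> + + H; case: H => {t s}
  [i t s H|t1 t2 s|t1 t2 s H|t1 t2 s H|t s1 s2|t s1 s2 H|t s1 s2 H] //= _ _.
- by left; case: i H; [left | right].
- by right; left; left.
- by right; left; right.
- by right; right; left.
- by right; right; right.
Qed.

(* Each approximation of [t] satisfies one of the finitely many alternatives of
   [tle_inv]; since the approximations are directed, one alternative holds for all. *)
Lemma tle_of_approx_step t :
  (forall s, (forall u, approx u t -> left_part (fun t1 => tle t1 s) u) -> tle t s) ->
  (forall s, (forall u, approx u t -> right_part (fun t2 => tle t2 s) u) -> tle t s) ->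
  ~~ is_join t -> forall s, (forall u, approx u t -> tle u s) -> tle t s.
Proof.
move=> Hl Hr nJ.
have cover_lim s i : (forall u, approx u t -> ole (up u i) (Some (lo s i))) -> tle t s.
  by move=> H; apply: (tle_cover i) => w /up_continuous[u [/H Hu /Hu]].
have split_tle s : ~~ is_meet s -> (forall u, approx u t -> tle u s) ->
    tle t s \/ forall u, approx u t -> join_parts u s.
  move=> nM H; pose cov i u := ole (up u i) (Some (lo s i)).
  have covC i : leafwise_closed (cov i) := leafwise_closed_cover i (lo s i).
  have lC := leafwise_closed_left _ (leafwise_closed_tle s).
  have rC := leafwise_closed_right _ (leafwise_closed_tle s).
  have lrC := leafwise_closed_or _ _ lC rC.
  have lrjC := leafwise_closed_or _ _ lrC (leafwise_closed_join_parts s).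
  have [|H1|H1] := approx_pigeonhole t _ _ (leafwise_closed_or _ _ (covC true) (covC false)) lrjC.
  - move=> u [cu ut]; apply: tle_inv => //; last exact: H.
    by move: ut nJ; case: (t) => [? ?|? ?|? ?] //; case: (u).
  - by left; case: (approx_pigeonhole t _ _ (covC true) (covC false) H1); exact: cover_lim.
  - have [H2|H2] := approx_pigeonhole t _ _ lrC (leafwise_closed_join_parts s) H1;
      last by right.
    by left; case: (approx_pigeonhole t _ _ lC rC H2); [exact: Hl | exact: Hr].
elim=> [k a|s1 IH1 s2 IH2|s1 IH1 s2 IH2] H.
(* [join_parts] is false at a generator, so the second alternative is refuted by any single
   approximation. *)
- case: (split_tle (Gen k a) isT H) => // HF; have [u /HF] := approx_exists t; by [].
- apply: tle_meetR; [apply: IH1 | apply: IH2] => u /H us; apply: tle_trans us _;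
    [apply: tle_meetL1 | apply: tle_meetL2]; exact: tle_refl.
- case: (split_tle (Join s1 s2) isT H) => // H1.
  have [] := approx_pigeonhole t _ _ (leafwise_closed_tle s1) (leafwise_closed_tle s2) H1.
    by move/IH1; exact: tle_joinR1.
  by move/IH2; exact: tle_joinR2.
Qed.

Lemma tle_of_approx t s : (forall u, approx u t -> tle u s) -> tle t s.
Proof.
elim: t s => [k a|t1 IH1 t2 IH2|t1 IH1 t2 IH2] s.
- by apply: tle_of_approx_step => // r H; have [u uk] := approx_exists (Gen k a);
    move: uk (H u uk) => {H}; case: u => [? ?|? ?|? ?] [] //=.
- apply: tle_of_approx_step => // r H.
    apply: tle_meetL1; apply: IH1 => u1 a1; have [u2 a2] := approx_exists t2.
    exact: (H _ (approx_Meet _ _ _ _ a1 a2)).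
  apply: tle_meetL2; apply: IH2 => u2 a2; have [u1 a1] := approx_exists t1.
  exact: (H _ (approx_Meet _ _ _ _ a1 a2)).
- move=> H; apply: tle_joinL; [apply: IH1 => u1 a1 | apply: IH2 => u2 a2].
    have [u2 a2] := approx_exists t2.
    apply: tle_trans (H _ (approx_Join _ _ _ _ a1 a2)).
    by apply: tle_joinR1; exact: tle_refl.
  have [u1 a1] := approx_exists t1.
  apply: tle_trans (H _ (approx_Join _ _ _ _ a1 a2)).
  by apply: tle_joinR2; exact: tle_refl.
Qed.

End Approximation.

(** * The embedding *)

Section ListTerms.
Context {O : Type}.
Local Notation T := (term (list (O * O))).

(** Lists of pairs instead of equivalences make the labels codable in [O]. Different lists may
    generate the same label, so [lterm_le] is only a preorder. *)
Definition eval_gen (u : T) : term (EqRel O) := term_map gen u.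
Definition lterm_le (u v : T) : Prop := tle (eval_gen u) (eval_gen v).
Definition lterm_zero : T := Gen true nil.
Definition below (t : term (EqRel O)) (u : T) : Prop := tle (eval_gen u) t.

Lemma eval_gen_compact u : compact (eval_gen u).
Proof. by elim: u => //= i l; exists l. Qed.

Lemma compact_eval_gen t : compact t -> exists u, eval_gen u = t.
Proof.
elim: t => [i a [l ->]|t IHt s IHs|t IHt s IHs] /=; first by exists (Gen i l).
- by move=> [/IHt[u <-] /IHs[v <-]]; exists (Meet u v).
- by move=> [/IHt[u <-] /IHs[v <-]]; exists (Join u v).
Qed.

Lemma lterm_zero_le u : lterm_le lterm_zero u.
Proof. by apply: tle_bot; exact: gen_ele. Qed.

Lemma lterm_le_joinl u v : lterm_le u (Join u v).
Proof. by apply: tle_joinR1; exact: tle_refl. Qed.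

Lemma lterm_le_joinr u v : lterm_le v (Join u v).
Proof. by apply: tle_joinR2; exact: tle_refl. Qed.

Lemma lterm_join_le u v w : lterm_le u w -> lterm_le v w -> lterm_le (Join u v) w.
Proof. exact: tle_joinL. Qed.

Lemma below_ideal t : ideal lterm_le Join lterm_zero (below t).
Proof.
split.
- by apply: tle_bot; exact: gen_ele.
- by move=> u v; exact: tle_trans.
- by move=> u v; exact: tle_joinL.
Qed.

Lemma below_meet t s : below (Meet t s) = ideal_meet (below t) (below s).
Proof.
apply/predeqP => u; split=> [H|[? ?]]; last exact: tle_meetR.
by split; apply: tle_trans H _; [apply: tle_meetL1 | apply: tle_meetL2]; exact: tle_refl.
Qed.

Lemma below_join t s : below (Join t s) = ideal_sup lterm_le Join (below t) (below s).
Proof.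
apply/predeqP => u; split=> [|[v [w [vt ws uvw]]]].
  (* The approximation of [Join t s] above [u] is itself a join, and its two halves are the members
     of the two ideals sought. *)
  move=> /(tle_approx _ _ (eval_gen_compact u))[[? ?|? ?|t' s'] [[ct ts] H]] //.
  case: ct ts H => /compact_eval_gen[v <-] /compact_eval_gen[w <-].
  by move=> [/leafwise_tle vt /leafwise_tle ws] H; exists v, w.
by apply: tle_trans uvw _; apply: tle_joinL; [exact: tle_joinR1 | exact: tle_joinR2].
Qed.

Lemma below_eq t s : tle t s -> tle s t -> below t = below s.
Proof.
by move=> ts st; apply/predeqP => u; split=> H; [exact: tle_trans ts | exact: tle_trans st].
Qed.

Lemma below_sub t s : (forall u, below t u -> below s u) -> tle t s.
Proof.
move=> ts; apply: tle_of_approx => _ [/compact_eval_gen[u <-] /leafwise_tle].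
exact: ts.
Qed.

Section Coding.
Context (p : O -> O -> O) (c : nat -> O).
Hypothesis p_inj : pairing p.
Hypothesis c_inj : forall m n, c m = c n -> m = n.

Fixpoint list_code (l : list (O * O)) : O :=
  match l with
  | nil => p (c 0) (c 0)
  | cons (x, y) l => p (c 1) (p (p x y) (list_code l))
  end.

Fixpoint term_code (t : T) : O :=
  match t with
  | Gen i l => p (c i) (list_code l)
  | Meet t s => p (c 2) (p (term_code t) (term_code s))
  | Join t s => p (c 3) (p (term_code t) (term_code s))
  end.

Lemma list_code_inj l l' : list_code l = list_code l' -> l = l'.
Proof.
elim: l l' => [|[x y] l IH] [|[x' y'] l'] //= /p_inj[/c_inj] // _.
by move=> /p_inj[/p_inj[-> ->] /IH ->].
Qed.

Lemma term_code_inj t t' : term_code t = term_code t' -> t = t'.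
Proof.
elim: t t' => [i l|t IHt s IHs|t IHt s IHs] [i' l'|t' s'|t' s'] //= /p_inj[/c_inj] //;
  do ?[by case: i | by case: i'].
- by case: i i' => -[] // _ /list_code_inj ->.
- by move=> _ /p_inj[/IHt -> /IHs ->].
- by move=> _ /p_inj[/IHt -> /IHs ->].
Qed.

End Coding.

End ListTerms.

Lemma term_representation (O : Type) : infinite O ->
  exists R : term (EqRel O) -> EqRel O,
  [/\ forall t s, R (Meet t s) = eq_meet (R t) (R s) /\ R (Join t s) = eq_join (R t) (R s),
      forall i, R (Gen i (eq_bot O)) = eq_bot O,
      forall t, (forall s, tle s t) -> R t = eq_top O,
      forall t s, tle t s -> tle s t -> R t = R s &
      forall t s, ele (R t) (R s) -> tle t s].
Proof.
move=> Oinf; have [c c_inj] := infinite_nat_inj _ Oinf.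
have [p p_inj] := infinite_pairing _ Oinf.
(* The pair [(c 0, c 1)] keeps the label nonzero; the trivial pair [(x, x)] changes the list but not
   the generated equivalence, and makes [d] injective. *)
pose d (x : O) : term (list (O * O)) := Gen true ((c 0, c 1) :: (x, x) :: nil).
have le_trans (u v w : term (list (O * O))) : lterm_le u v -> lterm_le v w -> lterm_le u w.
  exact: tle_trans.
have d_inj x y : d x = d y -> x = y by case.
have d_ne x : ~ lterm_le (d x) lterm_zero.
  move=> /(lo_mono _ _ true) /= H.
  have /(gen_ele nil (eq_bot O)) : sval (gen nil) (c 0) (c 1).
    by apply: H; apply: gen_in; left.
  by move=> /(_ (fun _ _ => False_ind _))/c_inj.
have code_inj := term_code_inj _ _ p_inj c_inj.
have [g [g_inj g_nf g_surj]] := normal_vertex_enum lterm_le Join lterm_zero _ _ _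
  p_inj c_inj code_inj d d_inj d_ne.
have z_le := @lterm_zero_le O; have join_l := @lterm_le_joinl O.
have join_r := @lterm_le_joinr O; have join_le := @lterm_join_le O.
exists (fun t => ideal_rep lterm_le Join g (below t)); split.
- move=> t s; have Ht := below_ideal t; have Hs := below_ideal s.
  rewrite below_meet below_join; split; first exact: (ideal_rep_meet _ _ lterm_zero).
  exact: (ideal_rep_sup _ _ lterm_zero).
- move=> i; rewrite -[RHS](ideal_rep_bot lterm_le Join lterm_zero g) //.
  congr (ideal_rep _ _ _ _); apply: (below_eq _ (eval_gen lterm_zero)).
    by apply: tle_bot; exact: ele_refl.
  by apply: tle_bot; exact: gen_ele.
- move=> t t_top; rewrite -(ideal_rep_total lterm_le Join g).
  by congr (ideal_rep _ _ _ _); apply/predeqP => u; split=> // _; exact: t_top.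
- by move=> t s ts st; rewrite (below_eq t s).
- move=> t s ts; apply: below_sub.
  exact: (ideal_rep_le lterm_le Join lterm_zero le_trans z_le join_le g g_surj _ _
    (below_ideal t) (below_ideal s) ts).
Qed.

Section LatticeWithZero.
Context (M : lat0) (HM : is_lattice0 M).
Implicit Types x y z : M.

Definition lle x y : Prop := lmeet x y = x.

Lemma lle_refl x : lle x x.
Proof. by have [_ [_ [_ [_ [mj [jm _]]]]]] := HM; rewrite /lle -{2}(jm x x) mj. Qed.

Lemma lle_trans x y z : lle x y -> lle y z -> lle x z.
Proof. by have [mA _] := HM; rewrite /lle => xy yz; rewrite -xy -mA yz. Qed.

Lemma lle_antisym x y : lle x y -> lle y x -> x = y.
Proof. by have [_ [_ [mC _]]] := HM; rewrite /lle => xy yx; rewrite -xy mC. Qed.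

Lemma lle_meetl x y : lle (lmeet x y) x.
Proof.
have [mA [_ [mC _]]] := HM; have := lle_refl x; rewrite /lle => xx.
by rewrite mC mA xx.
Qed.

Lemma lle_meetr x y : lle (lmeet x y) y.
Proof. by have [_ [_ [mC _]]] := HM; rewrite mC; exact: lle_meetl. Qed.

Lemma lle_meet x y z : lle z x -> lle z y -> lle z (lmeet x y).
Proof. by have [mA _] := HM; rewrite /lle mA => -> ->. Qed.

Lemma lle_joinE x y : lle x y <-> ljoin x y = y.
Proof.
have [_ [_ [mC [jC [mj [jm _]]]]]] := HM; rewrite /lle; split=> [<-|<-]; last exact: mj.
by rewrite jC mC jm.
Qed.

Lemma lle_joinl x y : lle x (ljoin x y).
Proof. by have [_ [_ [_ [_ [mj _]]]]] := HM; exact: mj. Qed.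

Lemma lle_joinr x y : lle y (ljoin x y).
Proof. by have [_ [_ [_ [jC _]]]] := HM; rewrite jC; exact: lle_joinl. Qed.

Lemma lle_join x y z : lle x z -> lle y z -> lle (ljoin x y) z.
Proof.
have [_ [jA _]] := HM; move=> /lle_joinE xz /lle_joinE yz; apply/lle_joinE.
by rewrite -jA yz.
Qed.

Lemma lle_zero x : lle lzero x.
Proof. by have [_ [_ [_ [_ [_ [_ j0]]]]]] := HM; apply/lle_joinE. Qed.

End LatticeWithZero.

Lemma EqL_lattice0 (O : Type) : is_lattice0 (EqL O).
Proof.
have jl := @ele_joinl O; have jr := @ele_joinr O.
split=> [x y z|]; first by apply: EqRel_ext => p q; rewrite !eq_meetE; tauto.
split=> [x y z|].
  apply: ele_antisym => /=; apply: join_ele; do ?[exact: jl | exact: jr | apply: join_ele].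
  - exact: ele_trans (jl x y) (jl _ z).
  - exact: ele_trans (jr x y) (jl _ z).
  - exact: ele_trans (jl y z) (jr x _).
  - exact: ele_trans (jr y z) (jr x _).
split=> [x y|]; first by apply: EqRel_ext => p q; rewrite !eq_meetE; tauto.
split=> [x y|]; first by apply: ele_antisym => /=; apply: join_ele.
split=> [x y|].
  by apply: ele_antisym; [exact: meet_elel | apply: ele_meet; [exact: ele_refl | exact: jl]].
split=> [x y|x]; apply: ele_antisym.
- by apply: join_ele; [exact: ele_refl | exact: meet_elel].
- exact: jl.
- by apply: join_ele; [exact: bot_ele | exact: ele_refl].
- exact: jr.
Qed.

(** * A given coproduct as an image of the terms *)

Section Coproduct.
Context (O : Type) (C : lat0) (i1 i2 : EqL O -> C).
Hypothesis HC : is_coproduct0 (EqL O) (EqL O) C i1 i2.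

Fixpoint term_value (t : term (EqRel O)) : C :=
  match t with
  | Gen i a => if i then i1 a else i2 a
  | Meet t s => lmeet (term_value t) (term_value s)
  | Join t s => ljoin (term_value t) (term_value s)
  end.

Definition term_image (x : C) : Prop := exists t, x = term_value t.

Lemma term_image_meet x y : term_image x -> term_image y -> term_image (lmeet x y).
Proof. by move=> [t ->] [s ->]; exists (Meet t s). Qed.

Lemma term_image_join x y : term_image x -> term_image y -> term_image (ljoin x y).
Proof. by move=> [t ->] [s ->]; exists (Join t s). Qed.

Lemma term_image_gen i (a : EqL O) : term_image (if i then i1 a else i2 a).
Proof. by exists (Gen i a). Qed.

Lemma term_image_zero : term_image lzero.
Proof. by have [_ [[_ [_ <-]] _]] := HC; exact: (term_image_gen true). Qed.

Definition generated : lat0 := Lat0 {x : C | term_image x}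
  (fun x y => exist _ _ (term_image_meet _ _ (proj2_sig x) (proj2_sig y)))
  (fun x y => exist _ _ (term_image_join _ _ (proj2_sig x) (proj2_sig y)))
  (exist _ _ term_image_zero).

(** The map from [C] to the generated sublattice, followed by inclusion, agrees with the identity on
    both factors, hence everywhere by uniqueness. *)
Lemma term_value_surj x : term_image x.
Proof.
have [HL [Hi1 [Hi2 univ]]] := HC.
have ext (y z : generated) : sval y = sval z -> y = z.
  by case: y z => [y Hy] [z Hz]; exact: eq_exist.
have HG : is_lattice0 generated.
  have [h1 [h2 [h3 [h4 [h5 [h6 h7]]]]]] := HL.
  by do 6?split; move=> *; apply: ext => /=.
pose f i (a : EqL O) : generated := exist _ _ (term_image_gen i a).
have Hf i : hom0 (EqL O) generated (f i).
  have [m1 [j1 z1]] := Hi1; have [m2 [j2 z2]] := Hi2.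
  by case: i; split; [|split| |split]; move=> *; apply: ext;
    do ?[exact: m1 | exact: j1 | exact: z1 | exact: m2 | exact: j2 | exact: z2].
have [h [[[hm [hj hz]] [h1 h2]] _]] := univ _ HG _ _ (Hf true) (Hf false).
have [k [_ k_uniq]] := univ _ HL _ _ Hi1 Hi2.
have kid : k = id by apply: k_uniq.
have kh : k = fun y => sval (h y).
  apply: k_uniq; split; first by split; [|split]; rewrite ?hz // => *; rewrite ?hm ?hj.
  by split=> a; rewrite ?h1 ?h2.
have -> : x = sval (h x) by rewrite -[in LHS](congr1 (fun F => F x) kid) kh.
exact: (proj2_sig (h x)).
Qed.

(** [lo] and [up] bound the value of a term in [C] from below and above, which validates the cover
    rule; the other rules hold in every lattice. *)
Lemma tle_sound t s : tle t s -> lle C (term_value t) (term_value s).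
Proof.
have [HL [[m1 [j1 z1]] [[m2 [j2 z2]] _]]] := HC.
pose inj i a := if i then i1 a else i2 a.
have injM i a b : inj i (eq_meet a b) = lmeet (inj i a) (inj i b).
  by case: i; [exact: m1 | exact: m2].
have injJ i a b : inj i (eq_join a b) = ljoin (inj i a) (inj i b).
  by case: i; [exact: j1 | exact: j2].
have inj0 i : inj i (eq_bot O) = lzero by case: i; [exact: z1 | exact: z2].
have inj_mono i a b : ele a b -> lle C (inj i a) (inj i b).
  move=> ab; rewrite /lle -injM; congr (inj i _).
  by apply: ele_antisym; [exact: meet_elel | exact: ele_meet].
have lo_le u i : lle C (inj i (lo u i)) (term_value u).
  elim: u => [j a|u IHu v IHv|u IHu v IHv] /=.
  - case: eqP => [->|_]; first exact: lle_refl.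
    by rewrite inj0; exact: lle_zero.
  - rewrite injM; apply: lle_meet => //.
      exact: (lle_trans _ HL _ _ _ (lle_meetl _ HL _ _) IHu).
    exact: (lle_trans _ HL _ _ _ (lle_meetr _ HL _ _) IHv).
  - rewrite injJ; apply: lle_join => //.
      exact: (lle_trans _ HL _ _ _ IHu (lle_joinl _ HL _ _)).
    exact: (lle_trans _ HL _ _ _ IHv (lle_joinr _ HL _ _)).
(* Clamping is sound because an element of [C] below the zero of one factor is zero, and both
   inclusions preserve zero. *)
have clamp_up x (f : bool -> option (EqRel O)) :
    (forall i a, f i = Some a -> lle C x (inj i a)) ->
    forall i a, clamp f i = Some a -> lle C x (inj i a).
  move=> H i a; have [/[dup] [[j fj]] /clamp_bot ->|/clampN ->] := EM (vanishing f);
    last exact: H.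
  move=> [<-]; case E : (f j) fj => [b|] fj; last by case: (ole_NoneF _ fj).
  apply: (lle_trans _ HL _ _ _ (H _ _ E)).
  apply: (lle_trans _ HL _ (inj j (eq_bot O))); first by apply: inj_mono; apply/ole_Some.
  by rewrite !inj0; exact: lle_refl.
have up_le u : forall i a, up u i = Some a -> lle C (term_value u) (inj i a).
  elim: u => [j b|u IHu v IHv|u IHu v IHv] /=.
  - by apply: clamp_up => i a; case: eqP => // -> [<-]; exact: lle_refl.
  - apply: clamp_up => i a.
    have Hl := lle_meetl _ HL (term_value u) (term_value v).
    have Hr := lle_meetr _ HL (term_value u) (term_value v).
    case Eu : (up u i) => [b|]; case Ev : (up v i) => [c|] //= [<-].
    + by rewrite injM; apply: lle_meet => //;
        [exact: (lle_trans _ HL _ _ _ Hl (IHu _ _ Eu)) |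
         exact: (lle_trans _ HL _ _ _ Hr (IHv _ _ Ev))].
    + exact: (lle_trans _ HL _ _ _ Hl (IHu _ _ Eu)).
    + exact: (lle_trans _ HL _ _ _ Hr (IHv _ _ Ev)).
  - move=> i a; case Eu : (up u i) => [b|]; case Ev : (up v i) => [c|] //= [<-].
    rewrite injJ; apply: lle_join => //.
      exact: (lle_trans _ HL _ _ _ (IHu _ _ Eu) (lle_joinl _ HL _ _)).
    exact: (lle_trans _ HL _ _ _ (IHv _ _ Ev) (lle_joinr _ HL _ _)).
elim=> {t s} [i t s H|t1 t2 s _ IH1 _ IH2|t1 t2 s _ IH|t1 t2 s _ IH|t s1 s2 _ IH1 _ IH2|
   t s1 s2 _ IH|t s1 s2 _ IH] /=.
- case E : (up t i) H => [a|] H; last by case: (ole_NoneF _ H).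
  apply: (lle_trans _ HL _ _ _ (up_le _ _ _ E)).
  by apply: (lle_trans _ HL _ _ _ _ (lo_le s i)); apply: inj_mono; apply/ole_Some.
- exact: lle_join.
- exact: (lle_trans _ HL _ _ _ (lle_meetl _ HL _ _) IH).
- exact: (lle_trans _ HL _ _ _ (lle_meetr _ HL _ _) IH).
- exact: lle_meet.
- exact: (lle_trans _ HL _ _ _ IH (lle_joinl _ HL _ _)).
- exact: (lle_trans _ HL _ _ _ IH (lle_joinr _ HL _ _)).
Qed.

End Coproduct.

Theorem theorem6p3 (Omega : Type) (Hinf : infinite Omega)
  (C : lat0) (i1 i2 : EqL Omega -> C)
  (HC : is_coproduct0 (EqL Omega) (EqL Omega) C i1 i2) :
  exists f : C -> EqL Omega,
    hom0 C (EqL Omega) f /\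
    (forall x y : C, f x = f y -> x = y) /\
    (exists t : C, (forall x : C, ljoin x t = t) /\ f t = eq_top Omega).
Proof.
have [R [RMJ R0 Rtop Req Rle]] := term_representation _ Hinf.
have RM t s : R (Meet t s) = eq_meet (R t) (R s) by have [] := RMJ t s.
have RJ t s : R (Join t s) = eq_join (R t) (R s) by have [] := RMJ t s.
have HR i : hom0 (EqL Omega) (EqL Omega) (fun a => R (Gen i a)).
  split; [|split] => [a b|a b|] /=.
  - rewrite -RM; apply: Req; last exact: tle_Gen_meet.
    by apply: tle_meetR; apply: tle_Gen; [exact: meet_elel | exact: meet_eler].
  - rewrite -RJ; apply: Req; first exact: tle_Gen_join.
    by apply: tle_joinL; apply: tle_Gen; [exact: ele_joinl | exact: ele_joinr].
  - exact: R0.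
have [HL [_ [_ univ]]] := HC.
have [f [[Hf [f1 f2]] _]] := univ _ (EqL_lattice0 Omega) _ _ (HR true) (HR false).
have [fm [fj _]] := Hf.
have fE t : f (term_value Omega C i1 i2 t) = R t.
  elim: t => [[] a|t IHt s IHs|t IHt s IHs] /=; do ?[exact: f1 | exact: f2].
  - by rewrite fm RM IHt IHs.
  - by rewrite fj RJ IHt IHs.
have surj := term_value_surj Omega C i1 i2 HC.
have sound := tle_sound Omega C i1 i2 HC.
exists f; split=> //; split.
  move=> x y; have [t ->] := surj x; have [s ->] := surj y; rewrite !fE => E.
  by apply: (lle_antisym _ HL); apply: sound; apply: Rle; rewrite E; exact: ele_refl.
(* The top of one factor does not dominate the other factor in [C], so the greatest element is the
   join of both tops. *)
pose top := Join (Gen true (eq_top Omega)) (Gen false (eq_top Omega)).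
have le_top t : tle t top.
  elim: t => [i a|t IHt s _|t IHt s IHs].
  - by case: i; [apply: tle_joinR1 | apply: tle_joinR2]; apply: tle_Gen.
  - exact: tle_meetL1.
  - exact: tle_joinL.
exists (term_value Omega C i1 i2 top); split; last by rewrite fE; exact: Rtop.
by move=> x; have [t ->] := surj x; apply/(lle_joinE _ HL); exact: sound.
Qed.
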